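(* Let $p_j\ge 1$ for any $1\le j\le k$ but let $p_j>1$ for some $j$. Let $u_0=(u_{0,1},\dots,u_{0,k})\in L^1(\mathbb R^n)\cap L^\infty(\mathbb R^n)$ satisfy that $u_{0,j}$ is nonnegative for any $j$. Let $u\in C([0,T_m);L^1(\mathbb R^n)\cap L^\infty(\mathbb R^n))$ be the corresponding solution of the system $$\partial_t u_j-\Delta u_j=|u_{j+1}|^{p_j}\quad(1\le j\le k,\ u_{k+1}:=u_1),\qquad u(0,x)=u_0(x),$$ where $T_m$ is its lifespan. If there exists $j_0\in\{1,\dots,k\}$ such that $u_{0,j_0}\not\equiv 0$ and $$\alpha_{j_0}>\frac n2,$$ then $u$ cannot exist globally and there exists $R_0>0$ such that $$T_m\le C_0\,U_{j_0,R_0}(0)^{-1/(\alpha_{j_0}-n/2)}$$ with some constant $C_0$.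
   Context: Here $n\ge 1$, $k\ge 1$, and $u=(u_1,\dots,u_k):[0,T)\times\mathbb R^n\to\mathbb R^k$ is the unknown. The lifespan $T_m$ is the supremum of all $T>0$ for which there exists a unique solution $u\in C([0,T);L^1(\mathbb R^n)\cap L^\infty(\mathbb R^n))$ of the system with initial data $u_0$. Exponents: for $(p_1,\dots,p_k)\ne(1,\dots,1)$, $$\alpha_j=\frac{\sum_{h=0}^{k-2}\prod_{m=0}^{h}p_{j+m}+1}{\prod_{m=1}^{k}p_m-1}\qquad(1\le j\le k),$$ where $p_i$ is interpreted as $p_{i-k}$ for $i>k$ (for $k=1$ the sum is empty). Equivalently, $p_j\alpha_{j+1}-\alpha_j=1$ for $1\le j\le k$, with $\alpha_{k+1}:=\alpha_1$. Test function: let $\lambda>0$ and a nonnegative function $\psi$ on $\mathbb R^n$ satisfy $\|\psi\|_{L^1}=1$, $-\Delta\psi=\frac\lambda2\psi>0$ for $|x|<1$, and $\psi=0$ for $|x|\ge 1$. That is, $\lambda/2$ is a positive eigenvalue of the Dirichlet Laplacian on the unit ball and $\psi$ is the extension by zero of the normalized positive eigenfunction. For $R>0$ put $\phi_R(x)=\psi(x/R)^2$ and $$U_{j,R}(t)=\int_{\mathbb R^n}u_j(t,x)\,\phi_R(x)\,dx\qquad(j=1,\dots,k).$$ *)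

(* Defs.v *)
From HB Require Import structures.
From mathcomp Require Import all_boot all_order all_algebra.
From mathcomp Require Import all_classical all_reals all_analysis.

Set Implicit Arguments.
Unset Strict Implicit.
Unset Printing Implicit Defensive.

Import Order.TTheory GRing.Theory Num.Theory.
Import numFieldNormedType.Exports.

Local Open Scope classical_set_scope.
Local Open Scope ring_scope.

(* R^n is 'rV[R]_n, with the product sigma-algebra of the Borel sets of R,
   i.e., the one generated by the coordinates. *)

Definition rV_display : measure_display. Proof. exact. Qed.

Section measurable_rV.
Variables (R : realType) (n : nat).

Let coord (i : 'I_n) (x : 'rV[R]_n) : measurableTypeR R := x ord0 i.

Let rV_set0 : g_sigma_preimage coord set0.
Proof. exact: sigma_algebra0. Qed.

Let rV_setC A : g_sigma_preimage coord A -> g_sigma_preimage coord (~` A).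
Proof. exact: sigma_algebraC. Qed.

Let rV_bigcup (F : (set 'rV[R]_n)^nat) :
  (forall i, g_sigma_preimage coord (F i)) ->
  g_sigma_preimage coord (\bigcup_i (F i)).
Proof. exact: sigma_algebra_bigcup. Qed.

HB.instance Definition _ := @isMeasurable.Build rV_display
  'rV[R]_n (g_sigma_preimage coord) rV_set0 rV_setC rV_bigcup.

End measurable_rV.

Lemma measurable_rV_coord (R : realType) n (i : 'I_n) :
  measurable_fun [set: 'rV[R]_n]
    (fun x : 'rV[R]_n => x ord0 i : measurableTypeR R).
Proof.
move=> _ Y mY; rewrite setTI; apply: sub_sigma_algebra => /=.
rewrite -bigcup_seq/=; exists i => /=; first by rewrite mem_index_enum.
by exists Y => //; rewrite setTI.
Qed.

Lemma measurable_rVP d (T : measurableType d) (R : realType) n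
    (f : T -> 'rV[R]_n) :
  (forall i, measurable_fun [set: T]
     (fun x => f x ord0 i : measurableTypeR R)) ->
  measurable_fun [set: T] f.
Proof.
move=> mf; apply: (@measurability _ _ _ _ _ _
  (\big[setU/set0]_(i < n) preimage_set_system setT
     (fun x : 'rV[R]_n => x ord0 i : measurableTypeR R) measurable)) => //.
move=> _ [B + <-]; rewrite -bigcup_seq/= => -[i _ [Y mY <-]].
by rewrite !setTI; have := mf i measurableT Y mY; rewrite setTI.
Qed.

Section rV_cons.
Variables (R : realType) (n : nat).

Definition rV_cons (z : measurableTypeR R * 'rV[R]_n) : 'rV[R]_n.+1 :=
  \row_i if unlift ord0 i is Some j then z.2 ord0 j else z.1.

Definition rV_uncons (x : 'rV[R]_n.+1) : measurableTypeR R * 'rV[R]_n :=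
  (x ord0 ord0, \row_j x ord0 (lift ord0 j)).

Lemma rV_consK : cancel rV_cons rV_uncons.
Proof.
move=> [a v]; congr pair; first by rewrite mxE unlift_none.
by apply/rowP => j; rewrite !mxE liftK.
Qed.

Lemma rV_unconsK : cancel rV_uncons rV_cons.
Proof.
move=> x; apply/rowP => i; rewrite mxE.
by case: unliftP => [j ->|->] //=; rewrite mxE.
Qed.

Lemma measurable_rV_cons : measurable_fun setT rV_cons.
Proof.
apply: measurable_rVP => i.
case: (unliftP ord0 i) => [j ->|->].
- rewrite (_ : (fun x => _) =
    (fun v : 'rV[R]_n => v ord0 j : measurableTypeR R) \o snd).
    exact: measurableT_comp (measurable_rV_coord j) measurable_snd.
  by apply/funext => z /=; rewrite mxE liftK.
- rewrite (_ : (fun x => _) = fst); first exact: measurable_fst.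
  by apply/funext => z /=; rewrite mxE unlift_none.
Qed.

Lemma measurable_rV_uncons : measurable_fun setT rV_uncons.
Proof.
apply/measurable_fun_pairP; split; first exact: measurable_rV_coord.
apply: measurable_rVP => j.
rewrite (_ : (fun x => _) =
  fun x : 'rV[R]_n.+1 => x ord0 (lift ord0 j) : measurableTypeR R).
  exact: measurable_rV_coord.
by apply/funext => x /=; rewrite mxE.
Qed.

HB.instance Definition _ :=
  isMeasurableFun.Build _ _ _ _ rV_cons measurable_rV_cons.

End rV_cons.

Section lebesgue_rV.
Local Open Scope ereal_scope.
Variable R : realType.

Section succ.
Variables (n : nat) (m : {sigma_finite_measure set 'rV[R]_n -> \bar R}).

Definition lebesgue_rV_succ : set 'rV[R]_n.+1 -> \bar R :=
  pushforward (@lebesgue_measure R \x m) (@rV_cons R n).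

Let succ0 : lebesgue_rV_succ set0 = 0.
Proof. exact: measure0. Qed.

Let succ_ge0 A : 0 <= lebesgue_rV_succ A.
Proof. exact: measure_ge0. Qed.

Let succ_sigma_additive : semi_sigma_additive lebesgue_rV_succ.
Proof. exact: measure_semi_sigma_additive. Qed.

HB.instance Definition _ := isMeasure.Build _ _ _ lebesgue_rV_succ
  succ0 succ_ge0 succ_sigma_additive.

Let succ_sigma_finite : sigma_finite setT lebesgue_rV_succ.
Proof.
have /sigma_finiteP[F [TF ndF Foo]] := sigma_finiteT (@lebesgue_measure R).
have /sigma_finiteP[G [TG ndG Goo]] := sigma_finiteT m.
exists (fun i => @rV_uncons R n @^-1` (F i `*` G i)).
  apply/esym; rewrite -subTset => x _.
  have [i _ Fi] : (\bigcup_i F i) (rV_uncons x).1 by rewrite -TF.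
  have [j _ Gj] : (\bigcup_i G i) (rV_uncons x).2 by rewrite -TG.
  exists (maxn i j) => //; split.
  - by move: Fi; exact/subsetPset/ndF/leq_maxl.
  - by move: Gj; exact/subsetPset/ndG/leq_maxr.
move=> i; have [? ?] := Foo i; have [? ?] := Goo i; split.
  rewrite -[X in measurable X]setTI; apply: measurable_rV_uncons => //.
  exact: measurableX.
rewrite /lebesgue_rV_succ /pushforward -comp_preimage.
rewrite (_ : _ \o _ = id); last by apply/funext => z /=; rewrite rV_consK.
by rewrite preimage_id product_measure1E// lte_mul_pinfty// ge0_fin_numE.
Qed.

HB.instance Definition _ :=
  Measure_isSigmaFinite.Build _ _ _ lebesgue_rV_succ succ_sigma_finite.

End succ.

(* n-dimensional Lebesgue measure; R^0 is one point of mass 1. *)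
Fixpoint lebesgue_rV n : {sigma_finite_measure set 'rV[R]_n -> \bar R} :=
  if n is m.+1 then lebesgue_rV_succ (lebesgue_rV m) else \d_(0%R : 'rV[R]_0).

Lemma lebesgue_rV_box n (B : 'I_n -> set (measurableTypeR R)) :
  (forall i, measurable (B i)) ->
  lebesgue_rV n [set x | forall i, B i (x ord0 i)] =
  \prod_(i < n) @lebesgue_measure R (B i).
Proof.
elim: n B => [|n ih] B mB.
  rewrite big_ord0 /= diracE (_ : _ \in _ = true)//.
  by apply/mem_set => -[].
rewrite big_ord_recl -ih//= /lebesgue_rV_succ /pushforward.
rewrite -product_measure1E//; last first.
  rewrite [X in measurable X](_ : _ = \bigcap_(i in [set: 'I_n])
    ((fun x : 'rV[R]_n => x ord0 i : measurableTypeR R) @^-1`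
      B (lift ord0 i))); last first.
    by apply/seteqP; split => [x + i _|x + i]; [exact|move/(_ i I)].
  apply: fin_bigcap_measurable => // i _.
  by rewrite -[X in measurable X]setTI; exact: measurable_rV_coord.
congr product_measure1; apply/seteqP; split => [[a v] /= Bav|[a v] /= [Ba Bv] i].
- split=> [|i]; first by have := Bav ord0; rewrite mxE unlift_none.
  by have := Bav (lift ord0 i); rewrite mxE liftK.
- by rewrite mxE; case: unliftP => [j ->|->].
Qed.

End lebesgue_rV.

Section euclidean.
Variables (R : realType) (n : nat).
Implicit Types (x : 'rV[R]_n) (f : 'rV[R]_n -> R) (A : set 'rV[R]_n).

(* The library norm on 'rV[R]_n is the sup norm. *)
Definition enorm x : R := Num.sqrt (\sum_i x ord0 i ^+ 2).

Definition unit_ball : set 'rV[R]_n := [set x | enorm x < 1].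

Definition partial (i : 'I_n) f : 'rV[R]_n -> R :=
  fun x => 'D_(delta_mx ord0 i) f x.

Definition laplacian f : 'rV[R]_n -> R :=
  fun x => \sum_i partial i (partial i f) x.

Definition C2_on A f :=
  forall x, A x ->
  [/\ differentiable f x,
      forall i, differentiable (partial i f) x &
      forall i j, {for x, continuous (partial j (partial i f))}].

End euclidean.

(* psi is the extension by zero of the L^1-normalized positive eigenfunction
   of the Dirichlet Laplacian on the unit ball, for the eigenvalue lambda / 2;
   the Dirichlet condition is the continuity of psi across the unit sphere. *)
Record is_ball_eigenfunction (R : realType) (n : nat) (lambda : R)
    (psi : 'rV[R]_n -> R) : Prop := IsBallEigenfunction {
  ball_eigen_ge0 : forall x, 0 <= psi x ;
  ball_eigen_continuous : continuous psi ;
  ball_eigen_C2 : C2_on (@unit_ball R n) psi ;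
  ball_eigen_norm : ('N[lebesgue_rV R n]_1 [EFin \o psi] = 1)%E ;
  ball_eigen_eq : forall x, enorm x < 1 ->
    - laplacian psi x = lambda / 2 * psi x ;
  ball_eigen_gt0 : forall x, enorm x < 1 -> 0 < lambda / 2 * psi x ;
  ball_eigen_out : forall x, 1 <= enorm x -> psi x = 0
}.

Section heat.
Variables (R : realType) (n : nat).

Definition heat_kernel (t : R) (x : 'rV[R]_n) : R :=
  (4 * pi * t) `^ (- (n%:R / 2)) * expR (- (enorm x ^+ 2 / (4 * t))).

(* (e^{t Delta} f)(x), for t > 0 *)
Definition heat_semigroup (t : R) (f : 'rV[R]_n -> R) (x : 'rV[R]_n) : R :=
  \int[lebesgue_rV R n]_y (heat_kernel t (x - y) * f y).

End heat.

Section system.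
Variables (R : realType) (n k : nat) (p : 'I_k -> R).

Local Notation mu := (lebesgue_rV R n).

Definition in_L1_Linfty (f : 'rV[R]_n -> R) :=
  f \in Lfun mu 1%E /\ f \in Lfun mu +oo%E.

Definition alpha (j : 'I_k) : R :=
  (\sum_(h < k.-1) \prod_(m < h.+1) p (iter m (@ordS k) j) + 1) /
  (\prod_(m < k) p m - 1).

Definition time_interval (T : \bar R) : set R :=
  [set t | 0 <= t /\ (t%:E < T)%E].

Definition in_C_L1_Linfty (T : \bar R) (u : R -> 'rV[R]_n -> R) :=
  (forall t, time_interval T t -> in_L1_Linfty (u t)) /\
  (forall t, time_interval T t ->
    ('N[mu]_1 [EFin \o (u s \- u t)%R]
       @[s --> within (time_interval T) (nbhs t)] --> 0)%E /\
    ('N[mu]_(+oo) [EFin \o (u s \- u t)%R]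
       @[s --> within (time_interval T) (nbhs t)] --> 0)%E).

(* Mild solutions on [0, T): u j t is a representative of u_j(t), and the
   system is read through Duhamel's formula. By the continuity of u, the time
   integrand is continuous and bounded in s on [0, t), hence integrable. *)
Record is_solution (u0 : 'I_k -> 'rV[R]_n -> R) (T : \bar R)
    (u : 'I_k -> R -> 'rV[R]_n -> R) : Prop := IsSolution {
  solution_class : forall j, in_C_L1_Linfty T (u j) ;
  solution_init : forall j, (0 < T)%E ->
    {ae mu, forall x, u j 0 x = u0 j x} ;
  solution_duhamel : forall j t, time_interval T t -> 0 < t ->
    {ae mu, forall x, u j t x = heat_semigroup t (u0 j) x +
      \int[lebesgue_measure]_(s in `]0, t[)
        heat_semigroup (t - s) (fun y => `|u (ordS j) s y| `^ p j) x}
}.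

Definition exists_unique_solution (u0 : 'I_k -> 'rV[R]_n -> R) (T : \bar R) :=
  exists2 u, is_solution u0 T u &
    forall v, is_solution u0 T v ->
      forall j t, time_interval T t ->
        {ae mu, forall x, v j t x = u j t x}.

Definition lifespan (u0 : 'I_k -> 'rV[R]_n -> R) : \bar R :=
  ereal_sup [set T%:E | T in
    [set T : R | 0 < T /\ exists_unique_solution u0 T%:E]].

End system.

Section test_function.
Variables (R : realType) (n k : nat) (psi : 'rV[R]_n -> R).

Definition phi (r : R) (x : 'rV[R]_n) : R := psi (r^-1 *: x) ^+ 2.

Definition moment (u : 'I_k -> R -> 'rV[R]_n -> R) (j : 'I_k) (r t : R) : R :=
  \int[lebesgue_rV R n]_x (u j t x * phi r x).

End test_function.

(* Main.v *)
Require Import Defs.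
From mathcomp Require Import all_boot all_order all_algebra.
From mathcomp Require Import all_classical all_reals all_analysis.
From mathcomp Require Import measurable_realfun ess_sup_inf ring lra.
Import Order.TTheory GRing.Theory Num.Theory.
Import numFieldNormedType.Exports.
Local Open Scope classical_set_scope.
Local Open Scope ring_scope.

(** The solution is tested against [phi_r = psi(./r)^2]: let [U_j(t)] be the
moment of [u_j(t)] and [P_t] the heat semigroup. For times up to [r^2] these
moments obey an integrated form of the differential inequalities
[U_j' >= - (lambda / r^2) U_j + c U_{j+1}^{p_j}], which force blow-up before
time [r^2] once [U_{j0}(0)] is large compared with a power of [r].

Solutions are mild, so no integration by parts against [phi_r] is available.
Instead, [P_t] is moved onto [phi_r] by symmetry of the kernel
([heat_semigroup_adjoint]), and the decisive property of [psi] is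
[P_t phi_r >= e^{- lambda t / r^2} phi_r] ([heat_phi_ge]). As [psi] is not C^2
across the unit sphere, this is proved for the truncation [max(psi - eps, 0)]
first: on the compact set [psi >= eps], Taylor's formula yields global quartic
minorants ([quartic_minorant]) whose Gaussian averages are explicit, hence
[P_h] decreases the truncation by a factor at worst [e^{- m h}], with
[m = lambda / 2], up to an error [O(eps h)], for all [h] below one threshold
([heat_truncation_step]). The semigroup law reaches any time, [eps] tends to
[0], and squaring doubles the rate ([heat_sqr_subsolution]).

Set [kappa = e^{- lambda}] and let [B], of order [r^n], bound the integral of
[phi_r]. Positivity of both terms of Duhamel's formula gives
[U_j(t) >= kappa U_j(0)] ([moment_ge_initial]), and Jensen's inequality turns
a bound [U_{j+1} >= B a] from time [t0] to [t] into
[U_j(t) >= (t - t0) kappa B a^{p_j}] ([moment_ge_source]).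

Going once around the cycle with waiting time [tau] for each component turns a
lower bound [a] of [U_{j0} / B] into [(kappa tau)^s a^P], where [P] is the
product of all [p_i] and [s = 1 + p_j + p_j p_{j+1} + ...] ([chain_step]). Since
[alpha_{j0} = s / (P - 1)], choosing [tau] proportional to [a^{- 1 / alpha}]
doubles [a]. The successive waiting times decrease geometrically, so the moment
would be infinite after a finite time of order [a^{- 1 / alpha}]
([blowup_time_lt]). With [a = kappa U_{j0}(0) / B] this means that the lifespan
is at most [r^2] as soon as [r^{2 alpha - n} U_{j0,r}(0)] reaches a constant [K]
([time_le_of_moment]).

Finally [r^{2 alpha - n} U_{j0,r}(0)] is continuous in [r] and, because
[2 alpha - n > 0], it tends to [0] as [r -> 0] and to [+oo] as [r -> +oo], where
[U_{j0,r}(0)] tends to [psi(0)^2] times the mass of [u_{0,j0}]. At a radius where it equals [K]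
([scale_balance]), [r^2] is a constant multiple of
[U_{j0,r}(0)^{- 1 / (alpha - n/2)}], which is the claim. *)

Set Implicit Arguments.
Unset Strict Implicit.
Unset Printing Implicit Defensive.

(** * Borel functions and integrals of products on R^n *)

Lemma floor_grid_close (R : realType) N (a : R) :
  `|a - (Num.floor (a * N.+1%:R))%:~R / N.+1%:R| <= N.+1%:R^-1.
Proof.
have /andP[h1 h2] := floor_itv (a * N.+1%:R).
rewrite intrD in h2.
have N0 : 0 < N.+1%:R :> R by [].
rewrite -{1}(mulfK (lt0r_neq0 N0) a) -mulrBl normrM (@ger0_norm _ N.+1%:R^-1) ?invr_ge0//.
rewrite ler_piMl ?invr_ge0//.
by rewrite ger0_norm ?subr_ge0//; lra.
Qed.

Section continuous_measurable.
Variables (R : realType) (n : nat).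
Implicit Types f : 'rV[R]_n -> R.

Definition grid_point (N : nat) (k : {ffun 'I_n -> int}) : 'rV[R]_n :=
  \row_i ((k i)%:~R / N.+1%:R).

Definition grid (N : nat) (x : 'rV[R]_n) : 'rV[R]_n :=
  grid_point N [ffun i => Num.floor (x ord0 i * N.+1%:R)].

Lemma grid_close N x : `|x - grid N x| <= N.+1%:R^-1.
Proof.
rewrite [leLHS]mx_normrE; apply/bigmax_leP; split => //= -[i j] _ /=.
by rewrite !mxE ffunE (ord1 i); exact: floor_grid_close.
Qed.

Lemma cvg_grid x : grid N x @[N --> \oo] --> x.
Proof.
apply/cvgrPdist_le => e e0.
have := @cvg_harmonic R.
move/cvgrPdist_le => /(_ e e0); apply: filterS => N /=.
rewrite sub0r normrN ger0_norm ?invr_ge0//.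
exact/le_trans/grid_close.
Qed.

(** A function of the grid point takes countably many values, each on a box. *)
Lemma measurable_comp_grid f N : measurable_fun setT (f \o grid N).
Proof.
move=> _ Y mY; rewrite setTI.
pose F (k : {ffun 'I_n -> int}) : set 'rV[R]_n :=
  if f (grid_point N k) \in Y then
    \bigcap_(i in [set: 'I_n]) [set x | Num.floor (x ord0 i * N.+1%:R) = k i]
  else set0.
have -> : (f \o grid N) @^-1` Y = \bigcup_k F k.
  apply/seteqP; split => x /=.
    move=> Yx; exists [ffun i => Num.floor (x ord0 i * N.+1%:R)] => //.
    by rewrite /F ifT ?inE// => i _ /=; rewrite ffunE.
  move=> [k _]; rewrite /F; case: ifPn => // /set_mem Yk h.
  rewrite /grid [finfun _](_ : _ = k)//.
  by apply/ffunP => i; rewrite ffunE; exact: h.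
apply: countable_bigcupT_measurable; first exact: countableP.
move=> k; rewrite /F; case: ifPn => _; last exact: measurable0.
apply: fin_bigcap_measurable => // i _.
rewrite [X in measurable X](_ : _ =
  (fun x : 'rV[R]_n => x ord0 i : measurableTypeR R) @^-1`
    `[(k i)%:~R / N.+1%:R, (k i + 1)%:~R / N.+1%:R[); last first.
  apply/seteqP; split => x /=; rewrite in_itv/= ler_pdivrMr// ltr_pdivlMr//.
    by move=> <-; exact: floor_itv.
  by move=> h; exact: floor_def.
rewrite -[X in measurable X]setTI; exact: measurable_rV_coord.
Qed.

(** The sigma-algebra of R^n is the product one, so Borel measurability of
continuous functions is not immediate: they are pointwise limits of their
values on finer and finer grids. *)
Lemma continuous_measurable_rV f : continuous f -> measurable_fun setT f.
Proof.
move=> cf; apply: (@measurable_fun_cvg _ _ _ setT (fun N => f \o grid N)) => //.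
- by move=> N; exact: measurable_comp_grid.
- by move=> x _; exact: (@cvg_comp _ _ _ (fun N => grid N x) f _ _ _ (@cvg_grid x) (cf x)).
Qed.
End continuous_measurable.

Section isint.
Context d (T : measurableType d) (R : realType).
Variable mu : {measure set T -> \bar R}.
Implicit Types (f g : T -> R) (v w c : R).

(** Integrability and the value are bundled so that linear combinations of
integrals can be computed without separate side conditions. *)
Definition isint f v :=
  mu.-integrable setT (EFin \o f) /\ (\int[mu]_x (f x)%:E = v%:E)%E.

Lemma isint_ext f g v : f =1 g -> isint f v -> isint g v.
Proof. by move=> /funext ->. Qed.

Lemma isint_integrable f : mu.-integrable setT (EFin \o f) ->
  isint f (\int[mu]_x f x).
Proof. by move=> h; split => //; rewrite /Rintegral fineK//; exact: integrable_fin_num. Qed.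

Lemma isint_Rintegral f v : isint f v -> \int[mu]_x f x = v.
Proof. by move=> [_ h]; rewrite /Rintegral h. Qed.

Lemma isintD f g v w : isint f v -> isint g w -> isint (fun x => f x + g x) (v + w).
Proof.
move=> [fi fv] [gi gw]; split; first exact: (integrableD _ fi gi).
by rewrite (integralD_EFin measurableT fi gi)/= fv gw.
Qed.

Lemma isintZ c f v : isint f v -> isint (fun x => c * f x) (c * v).
Proof.
move=> [fi fv]; split; first exact: (integrableZl measurableT c fi).
by under eq_integral do rewrite EFinM; rewrite (integralZl measurableT fi) fv.
Qed.

Lemma isintB f g v w : isint f v -> isint g w -> isint (fun x => f x - g x) (v - w).
Proof.
move=> fi gi; rewrite -mulN1r.
apply: isint_ext (isintD fi (isintZ (-1) gi)) => x; by rewrite mulN1r.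
Qed.

Lemma isint0 : isint (fun=> 0) 0.
Proof. by split; [exact: integrable0|exact: integral0]. Qed.

Lemma isint_sum (I : Type) (s : seq I) (f : I -> T -> R) (v : I -> R) :
  (forall i, isint (f i) (v i)) ->
  isint (fun x => \sum_(i <- s) f i x) (\sum_(i <- s) v i).
Proof.
move=> h; elim: s => [|i s ih].
  rewrite big_nil; apply: isint_ext isint0 => x; by rewrite big_nil.
rewrite big_cons; apply: isint_ext (isintD (h i) ih) => x; by rewrite big_cons.
Qed.

Lemma isint_le f g v w : isint f v -> isint g w -> (forall x, f x <= g x) -> v <= w.
Proof.
move=> [fi fv] [gi gw] fg; rewrite -lee_fin -fv -gw.
by apply: le_integral => // x _; rewrite lee_fin.
Qed.

End isint.

Lemma isint_prod_measure d1 d2 (T1 : measurableType d1) (T2 : measurableType d2)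
    (R : realType) (m1 : {sigma_finite_measure set T1 -> \bar R})
    (m2 : {sigma_finite_measure set T2 -> \bar R}) (f : T1 -> R) (g : T2 -> R)
    (v w : R) :
  isint m1 f v -> isint m2 g w ->
  isint (m1 \x m2)%E (fun z => f z.1 * g z.2) (v * w).
Proof.
move=> [fi fv] [gi gw].
have mfg : measurable_fun setT (fun z : T1 * T2 => f z.1 * g z.2).
  apply: measurable_funM.
    by apply: measurableT_comp measurable_fst; apply/measurable_EFinP; exact: measurable_int fi.
  by apply: measurableT_comp measurable_snd; apply/measurable_EFinP; exact: measurable_int gi.
have ifg : (m1 \x m2)%E.-integrable setT (EFin \o (fun z : T1 * T2 => f z.1 * g z.2)).
  have /integrable12ltyP -> : measurable_fun setT (EFin \o (fun z : T1 * T2 => f z.1 * g z.2)) by exact/measurable_EFinP => /=.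
  under eq_integral.
    move=> x _; under eq_integral do rewrite /= normrM EFinM.
    have : m2.-integrable setT (fun y => `|g y|%:E) by exact: (integrable_norm gi).
    move=> h; rewrite (integralZl measurableT h).
    over.
  have h1 := isint_integrable (integrable_norm fi).
  have h2 := isint_integrable (integrable_norm gi).
  rewrite (proj2 h2).
  rewrite (@integralZr _ _ _ _ _ measurableT _ (proj1 h1)) (proj2 h1).
  by rewrite -EFinM ltry.
split => //.
rewrite -(integral12_prod_meas1 ifg) /fubini_F/=.
under eq_integral.
  move=> x _; under eq_integral do rewrite EFinM.
  rewrite (integralZl measurableT gi) gw.
  over.
by rewrite (@integralZr _ _ _ _ _ measurableT _ fi) fv.
Qed.

(** Reduces every Gaussian integral on R^n to dimension one. The factors may
change sign, which is why Tonelli's theorem for nonnegative functions does not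
suffice. *)
Lemma isint_prod_coord (R : realType) n (F : 'I_n -> R -> R) (v : 'I_n -> R) :
  (forall i, isint (@lebesgue_measure R) (F i) (v i)) ->
  isint (lebesgue_rV R n) (fun x => \prod_i F i (x ord0 i)) (\prod_i v i).
Proof.
elim: n F v => [|n ih] F v Fv.
  rewrite big_ord0; split.
    apply: (@eq_integrable _ _ _ _ _ measurableT (cst 1%E)).
      by move=> x _ /=; rewrite big_ord0.
    exact: (@finite_measure_integrable_cst _ _ _ (\d_(0 : 'rV[R]_0)) setT 1 measurableT).
  under eq_integral do rewrite big_ord0.
  by rewrite integral_cst//= diracT mule1.
have mprod : measurable_fun setT (fun x : 'rV[R]_n.+1 => \prod_i F i (x ord0 i)).
  apply: measurable_prod => i _.
  have [Fi _] := Fv i.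
  have := measurable_int _ Fi; move/measurable_EFinP => mF.
  apply: (measurableT_comp mF); exact: measurable_rV_coord.
have := isint_prod_measure (Fv ord0) (ih _ _ (fun i => Fv (lift ord0 i))).
rewrite -(big_ord_recl _ (fun i : 'I_n.+1 => v i)) => -[hi hv].
have E : (fun z : measurableTypeR R * 'rV[R]_n => F ord0 z.1 * \prod_i F (lift ord0 i) (z.2 ord0 i)) =
    (fun x : 'rV[R]_n.+1 => \prod_i F i (x ord0 i)) \o @rV_cons R n.
  apply/funext => z /=; rewrite big_ord_recl mxE unlift_none; congr (_ * _).
  by apply: eq_bigr => i _; rewrite mxE liftK.
rewrite E in hi hv.
split.
  exact: (integrable_pushforward (@measurable_rV_cons R n) (measurableT_comp (@EFin_measurable _ _) mprod)).
etransitivity.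
  exact: (integral_pushforward (@measurable_rV_cons R n) (measurableT_comp (@EFin_measurable _ _) mprod) hi measurableT).
rewrite preimage_setT -hv; apply: eq_integral => z _.
by congr EFin; exact: (congr1 (@^~ z) (esym E)).
Qed.

(** * Gaussian moments and the heat kernel *)

Section gauss1.
Variable R : realType.
Implicit Types (h s t a b z : R).

Local Notation leb := (@lebesgue_measure R).

Definition heat1 h z := (Num.sqrt (4 * pi * h))^-1 * expR (- (z ^+ 2 / (4 * h))).

Lemma heat1_ge0 h z : 0 <= heat1 h z.
Proof. by rewrite mulr_ge0// ?expR_ge0// invr_ge0 sqrtr_ge0. Qed.

Lemma heat1_le h z : 0 <= h -> heat1 h z <= (Num.sqrt (4 * pi * h))^-1.
Proof.
move=> h0; rewrite ler_piMr ?invr_ge0 ?sqrtr_ge0// -[leRHS]expR0 ler_expR oppr_le0.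
by rewrite divr_ge0 ?sqr_ge0// mulr_ge0.
Qed.

(** The heat kernel at time [h] is the normal density of variance [2 h]. *)
Lemma heat1_normal_pdf h a b : 0 < h ->
  heat1 h (b - a) = normal_pdf a (Num.sqrt (2 * h)) b.
Proof.
move=> h0; have h2 : 0 < 2 * h by lra.
rewrite normal_pdfE ?gt_eqF ?sqrtr_gt0// /normal_peak /normal_fun /heat1.
rewrite sqr_sqrtr ?(ltW h2)//; congr (_^-1 * expR _); last by field; rewrite gt_eqF.
by congr Num.sqrt; ring.
Qed.

Lemma isint_heat1 h a : 0 < h -> isint leb (fun b => heat1 h (b - a)) 1.
Proof.
move=> h0.
have H : isint leb (normal_pdf a (Num.sqrt (2 * h))) 1.
  by split; [exact: integrable_normal_pdf|exact: integral_normal_pdf].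
by apply: isint_ext H => b; rewrite heat1_normal_pdf.
Qed.

(** Completing the square in [c]: the product is a constant times a Gaussian
of time [s t / (s + t)] centred at [(t a + s b) / (s + t)]. *)
Lemma heat1_chapman_kolmogorov s t a b : 0 < s -> 0 < t ->
  isint leb (fun c => heat1 s (a - c) * heat1 t (c - b)) (heat1 (s + t) (a - b)).
Proof.
move=> s0 t0; have st0 : 0 < s + t by lra.
pose h := s * t / (s + t); pose m := (t * a + s * b) / (s + t).
have h0 : 0 < h by rewrite divr_gt0// mulr_gt0.
rewrite -[X in isint _ _ X]mulr1.
apply: isint_ext (isintZ (heat1 (s + t) (a - b)) (isint_heat1 m h0)) => c.
have p0 := pi_gt0 R.
rewrite /heat1 mulrACA -expRD [RHS]mulrACA -expRD.
rewrite -!invfM -!sqrtrM; try by rewrite !mulr_ge0// ltW.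
congr (_^-1 * expR _).
  by congr Num.sqrt; rewrite /h; field; rewrite gt_eqF.
by rewrite /h /m; field; rewrite !gt_eqF.
Qed.

(** A polynomial weight only costs a factor 2 in time; this gives the
integrability of all moments and the vanishing of boundary terms. *)
Lemma poly_heat1_le h e : 0 < h -> exists2 C, 0 < C &
  forall z, `|z| ^+ e * heat1 h z <= C * heat1 (2 * h) z.
Proof.
move=> h0; pose A := 1 + (8 * h) ^+ e * (e`!)%:R.
have fac0 : 0 < (e`!)%:R :> R by rewrite ltr0n fact_gt0.
have A0 : 0 < A by rewrite ltr_pwDl// mulr_ge0// ?ltW// exprn_gt0//; lra.
have expX (x : R) : 0 <= x -> x ^+ e <= (e`!)%:R * expR x.
  move=> x0; case: (e) => [|k]; first by rewrite expr0 fact0 mul1r -expR0 ler_expR.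
  have := expR_ge1Dxn k x0; rewrite -ler_pdivrMl ?ltr0n ?fact_gt0//.
  by rewrite mulrC; lra.
have bnd z : `|z| ^+ e <= A * expR (z ^+ 2 / (8 * h)).
  apply: (@le_trans _ _ (1 + (z ^+ 2) ^+ e)).
    rewrite -(real_normK (num_real z)) exprAC.
    by have := sqr_ge0 (`|z| ^+ e - 2^-1); lra.
  have x0 : 0 <= z ^+ 2 / (8 * h) by rewrite divr_ge0 ?sqr_ge0//; lra.
  have h80 : 8 * h != 0 by rewrite gt_eqF//; lra.
  rewrite /A mulrDl mul1r; apply: lerD; first by rewrite -[leLHS]expR0 ler_expR.
  rewrite -[leLHS](mulfVK (expf_neq0 e h80)) -exprVn -exprMn mulrC -mulrA.
  by rewrite ler_pM2l ?exprn_gt0//; [exact: expX|lra].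
(* The exponential of z^2 / (8 h) is what separates heat1 h from heat1 (2 h),
   up to the ratio sqrt 2 of the normalizations. *)
exists (A * Num.sqrt 2) => [|z]; first by rewrite mulr_gt0// sqrtr_gt0.
have hE : heat1 h z = Num.sqrt 2 * heat1 (2 * h) z * expR (- (z ^+ 2 / (8 * h))).
  have ph : 0 <= 4 * pi * h :> R by rewrite !mulr_ge0 ?pi_ge0// ltW.
  rewrite /heat1 (_ : 4 * pi * (2 * h) = 2 * (4 * pi * h)); last by ring.
  rewrite (@sqrtrM _ 2)//; set Y := Num.sqrt (4 * pi * h).
  rewrite (invfM (Num.sqrt 2) Y) -!(mulrA (Num.sqrt 2)^-1) mulVKf ?gt_eqF ?sqrtr_gt0//.
  rewrite -(mulrA Y^-1) -expRD.
  congr (_ * expR _).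
  by field; rewrite gt_eqF.
have := ler_wpM2r (expR_ge0 (- (z ^+ 2 / (8 * h)))) (bnd z).
rewrite -(mulrA A) -expRD subrr expR0 mulr1 => hA.
rewrite hE [leLHS](_ : _ = `|z| ^+ e * expR (- (z ^+ 2 / (8 * h))) *
  (Num.sqrt 2 * heat1 (2 * h) z)); last by ring.
by rewrite -[leRHS]mulrA ler_wpM2r// mulr_ge0 ?sqrtr_ge0 ?heat1_ge0.
Qed.

Lemma measurable_heat1 h : measurable_fun setT (heat1 h).
Proof.
apply: measurable_funM => //; apply: measurableT_comp => //.
apply: measurableT_comp => //; apply: measurable_funM => //.
Qed.

Lemma integrable_poly_heat1 h e a : 0 < h ->
  leb.-integrable setT (EFin \o (fun b => (b - a) ^+ e * heat1 h (b - a))).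
Proof.
move=> h0; have [C C0 hC] := poly_heat1_le e h0.
have h20 : 0 < 2 * h by lra.
have [] := isintZ C (isint_heat1 a h20) => hi _.
apply: le_integrable hi => //.
  apply/measurable_EFinP; apply: measurable_funM.
    by apply: measurable_funX; apply: measurable_funB.
  by apply: measurableT_comp; [exact: measurable_heat1|apply: measurable_funB].
move=> b _ /=; rewrite lee_fin (normrM (_ ^+ e)) (normrM C) normrX.
by rewrite !(ger0_norm (heat1_ge0 _ _)) (ger0_norm (ltW C0)).
Qed.

(** The fundamental theorem of calculus on the whole line, exhausting it by
intervals centred at [a]: as [f] is integrable, their symmetric limit determines
the integral. *)
Lemma isint_of_primitive (f F : R -> R) a l :
  leb.-integrable setT (EFin \o f) -> continuous f ->
  (forall x : R, is_derive x 1 F (f x)) ->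
  F (a + N%:R) - F (a - N%:R) @[N --> \oo] --> l ->
  isint leb f l.
Proof.
move=> fi cf dF Fl; split => //.
pose I N : set R := `[a - N%:R, a + N%:R]%classic.
have mf := measurable_int _ fi.
have cvgI : (\int[leb]_x ((EFin \o f) \_ (I N)) x)%E @[N --> \oo] -->
    (\int[leb]_x (f x)%:E)%E.
  apply: (@dominated_cvg _ _ _ leb setT measurableT (fun N => (EFin \o f) \_ (I N))
    (EFin \o f) (abse \o (EFin \o f))) => //.
  - by move=> N; apply/(measurable_restrictT _ _).1; [exact: measurable_itv|exact: measurable_funTS].
  - move=> x _; apply: cvg_near_cst.
    near=> N; rewrite patchE ifT// inE /I /= in_itv/=.
    have : `|x - a| <= N%:R by near: N; exact: nbhs_infty_ger.
    by rewrite ler_norml; lra.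
  - exact: integrable_abse.
  - move=> N x _; rewrite patchE; case: ifPn => //; rewrite abse0 => _.
    exact: abse_ge0.
have cF : (F (a + N%:R) - F (a - N%:R))%:E @[N --> \oo] --> l%:E.
  by apply: cvg_comp Fl _; exact: cvg_id.
apply: cvg_unique cvgI _ => //.
apply: cvg_trans cF; apply: near_eq_cvg; near=> N.
have N0 : a - N%:R < a + N%:R.
  have : 0 < N%:R :> R by rewrite ltr0n; near: N; exact: nbhs_infty_gt.
  by lra.
have dF' (x : R) : derivable F x 1 by case: (dF x).
have cF' (x : R) : F @ x --> F x by apply: differentiable_continuous; exact/derivable1_diffP.
rewrite -integral_mkcond (continuous_FTC2 (F := F) N0)//.
- exact: continuous_subspaceT.
- split => //.
  + exact: cvg_at_right_filter.
  + exact: cvg_at_left_filter.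
- by move=> x _; rewrite derive1E; case: (dF x).
Unshelve. all: end_near. Qed.

Lemma is_derive_heat1 h a (x : R) : 0 < h ->
  is_derive x 1 (fun b => heat1 h (b - a)) (- (x - a) / (2 * h) * heat1 h (x - a)).
Proof.
move=> h0; rewrite /heat1.
apply: is_derive_eq.
by rewrite /GRing.scale /=; field; rewrite !gt_eqF ?sqrtr_gt0 ?mulr_gt0 ?pi_gt0.
Qed.

Lemma continuous_heat1 h a : 0 < h -> continuous (fun b : R => heat1 h (b - a)).
Proof.
by move=> h0 x; apply/differentiable_continuous/derivable1_diffP; case: (is_derive_heat1 a x h0).
Qed.

Lemma is_derive_shiftX e a (x : R) :
  is_derive x 1 (fun b => (b - a) ^+ e) (e%:R * (x - a) ^+ e.-1).
Proof.
have D1 : is_derive x 1 (fun b : R => b - a) 1.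
  by apply: is_derive_eq; rewrite subr0.
have := is_deriveX e D1; rewrite exprfctE => D.
by apply: (is_derive_eq D); rewrite /GRing.scale /= mulr1.
Qed.

(** The integrand is the derivative of [- 2 h (b - a)^e] times the kernel. For
[e = 0] the second term has coefficient [0], so that the junk value of [e.-1]
does not matter. *)
Lemma isint_moment_rec h e a : 0 < h ->
  isint leb (fun b => (b - a) ^+ e.+1 * heat1 h (b - a)
                 - 2 * h * e%:R * ((b - a) ^+ e.-1 * heat1 h (b - a))) 0.
Proof.
move=> h0; have h20 : 0 < 2 * h by rewrite mulr_gt0.
have cX k : continuous (fun b : R => (b - a) ^+ k * heat1 h (b - a)).
  have cS : continuous (fun b : R => (b - a) ^+ k).
    by move=> y; apply/differentiable_continuous/derivable1_diffP; case: (is_derive_shiftX k a y).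
  by move=> x; exact: (cvgM (cS x) (@continuous_heat1 h a h0 x)).
pose F (b : R) := - (2 * h) * ((b - a) ^+ e * heat1 h (b - a)).
pose f (b : R) := (b - a) ^+ e.+1 * heat1 h (b - a) - 2 * h * e%:R * ((b - a) ^+ e.-1 * heat1 h (b - a)).
apply: (@isint_of_primitive f F a 0); rewrite {}/f {}/F.
- have i1 := integrable_poly_heat1 e.+1 a h0.
  have i2 := isint_integrable (integrable_poly_heat1 e.-1 a h0).
  exact: (isintB (isint_integrable i1) (isintZ (2 * h * e%:R) i2)).1.
- move=> x; apply: cvgB; first exact: cX.
  by apply: cvgM; [exact: cvg_cst|exact: cX].
- move=> x; have D := is_deriveZ (- (2 * h)) (is_deriveM (is_derive_shiftX e a x) (is_derive_heat1 a x h0)).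
  apply: (is_derive_eq D).
  by rewrite /GRing.scale /= exprS; field; rewrite gt_eqF.
- have [C C0 hC] := poly_heat1_le e.+1 h0.
  pose D := 2 * h * C * (Num.sqrt (4 * pi * (2 * h)))^-1.
  have D0 : 0 <= D by rewrite !mulr_ge0 ?invr_ge0 ?sqrtr_ge0// ltW.
  have bnd (z : R) (N : nat) : `|z| = N.+1%:R -> `|z ^+ e * heat1 h z * (2 * h)| <= D * N.+1%:R^-1.
    move=> zN; rewrite ler_pdivlMr// (normrM _ (2 * h)) (normrM (_ ^+ e)) normrX (ger0_norm (heat1_ge0 _ _)).
    rewrite -zN [X in X <= _](_ : _ = `|2 * h| * (`|z| ^+ e.+1 * heat1 h z)); last by rewrite exprS; ring.
    rewrite ger0_norm /D -?mulrA ?ler_pM2l//; last by rewrite mulr_ge0 ?ltW.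
    apply: (le_trans (hC z)); rewrite ler_pM2l//.
    by rewrite (mulrA 4) heat1_le// ltW.
  have nE1 (n : nat) : a + n%:R - a = n%:R by ring.
  have nE2 (n : nat) : a - n%:R - a = - n%:R by ring.
  apply/cvgrPdist_le => eps eps0; near=> N.
  have N0 : (0 < N)%N by near: N; exact: nbhs_infty_gt.
  have NE : 2 * D / N%:R <= eps.
    rewrite ler_pdivrMr ?ltr0n// -ler_pdivrMl//.
    by near: N; exact: nbhs_infty_ger.
  rewrite nE1 nE2 sub0r normrN; apply: le_trans NE.
  rewrite -(prednK N0) (le_trans (ler_normB _ _))//.
  rewrite [leRHS](_ : _ = D / N.-1.+1%:R + D / N.-1.+1%:R); last by ring.
  by apply: lerD; rewrite mulrC mulrN normrN; apply: bnd; rewrite ?normrN ger0_norm.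
Unshelve. all: end_near. Qed.

Lemma isint_moment1 h a : 0 < h ->
  isint leb (fun b => (b - a) ^+ 1 * heat1 h (b - a)) 0.
Proof.
move=> h0; apply: isint_ext (isint_moment_rec 0 a h0) => b.
by rewrite mulr0 mul0r subr0.
Qed.

Lemma isint_moment_step h e a M : 0 < h ->
  isint leb (fun b => (b - a) ^+ e * heat1 h (b - a)) M ->
  isint leb (fun b => (b - a) ^+ e.+2 * heat1 h (b - a)) (2 * h * e.+1%:R * M).
Proof.
move=> h0 hM; rewrite -[_ * M]add0r.
apply: isint_ext (isintD (isint_moment_rec e.+1 a h0) (isintZ (2 * h * e.+1%:R) hM)) => b.
by rewrite /= subrK.
Qed.

Lemma isint_moment2 h a : 0 < h ->
  isint leb (fun b => (b - a) ^+ 2 * heat1 h (b - a)) (2 * h).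
Proof.
move=> h0; have H : isint leb (fun b => (b - a) ^+ 0 * heat1 h (b - a)) 1.
  by apply: isint_ext (isint_heat1 a h0) => b; rewrite expr0 mul1r.
by have := isint_moment_step h0 H; rewrite !mulr1.
Qed.

Lemma isint_moment4 h a : 0 < h ->
  isint leb (fun b => (b - a) ^+ 4 * heat1 h (b - a)) (12 * h ^+ 2).
Proof.
move=> h0; have := isint_moment_step h0 (isint_moment2 a h0).
by rewrite [X in isint _ _ X](_ : _ = 12 * h ^+ 2)//; ring.
Qed.

End gauss1.

Section heat_kernel.
Variables (R : realType) (n : nat).
Implicit Types (h s t : R) (x y z : 'rV[R]_n).

Local Notation mu := (lebesgue_rV R n).
Local Notation leb := (@lebesgue_measure R).

Lemma enorm_sqr x : enorm x ^+ 2 = \sum_i x ord0 i ^+ 2.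
Proof. by rewrite sqr_sqrtr// sumr_ge0// => i _; exact: sqr_ge0. Qed.

(** Gives access to the one-dimensional computations. *)
Lemma heat_kernel_prod h x : 0 < h -> heat_kernel h x = \prod_i heat1 h (x ord0 i).
Proof.
move=> h0; have p0 : 0 <= 4 * pi * h by rewrite !mulr_ge0 ?pi_ge0// ltW.
rewrite /heat_kernel /heat1 big_split/= -expR_sum prodr_const card_ord.
congr (_ * expR _); last by rewrite enorm_sqr mulr_suml -sumrN.
rewrite powRN (mulrC n%:R) powRrM powR12_sqrt// powR_mulrn ?sqrtr_ge0//.
by rewrite exprVn.
Qed.

Lemma heat_kernel_ge0 h x : 0 <= heat_kernel h x.
Proof. by rewrite mulr_ge0 ?powR_ge0 ?expR_ge0. Qed.

Lemma heat_kernelN h x : heat_kernel h (- x) = heat_kernel h x.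
Proof.
rewrite /heat_kernel (_ : enorm (- x) = enorm x)// /enorm; congr Num.sqrt.
by apply: eq_bigr => i _; rewrite mxE sqrrN.
Qed.

Lemma heat_kernelC h x y : heat_kernel h (x - y) = heat_kernel h (y - x).
Proof. by rewrite -heat_kernelN opprB. Qed.

Lemma measurable_heat_kernel h : measurable_fun setT (@heat_kernel R n h).
Proof.
apply: measurable_funM => //; apply: measurableT_comp => //.
apply: measurableT_comp => //; apply: measurable_funM => //.
rewrite (_ : (fun x => _) = fun x : 'rV[R]_n => \sum_i x ord0 i ^+ 2).
  apply: measurable_sum => i; apply: measurable_funX; exact: measurable_rV_coord.
by apply/funext => x; rewrite enorm_sqr.
Qed.

Lemma isint_heat_kernel_moment h x (e : 'I_n -> nat) (M : 'I_n -> R) : 0 < h ->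
  (forall i, isint leb (fun b => (b - x ord0 i) ^+ e i * heat1 h (b - x ord0 i)) (M i)) ->
  isint mu (fun y => heat_kernel h (x - y) * \prod_i (y - x) ord0 i ^+ e i) (\prod_i M i).
Proof.
move=> h0 /isint_prod_coord; apply: isint_ext => y.
rewrite big_split/= heat_kernelC heat_kernel_prod// mulrC.
by congr (_ * _); apply: eq_bigr => i _; rewrite !mxE.
Qed.

Lemma isint_heat_kernel h x : 0 < h -> isint mu (fun y => heat_kernel h (x - y)) 1.
Proof.
move=> h0; have := @isint_heat_kernel_moment h x (fun=> 0%N) (fun=> 1) h0.
rewrite big1// => H; apply: isint_ext (H _) => [y|i].
  by rewrite mulr1.
by apply: isint_ext (isint_heat1 _ h0) => b; rewrite expr0 mul1r.
Qed.

Lemma heat_kernel_chapman_kolmogorov s t x y : 0 < s -> 0 < t ->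
  isint mu (fun z => heat_kernel s (x - z) * heat_kernel t (z - y)) (heat_kernel (s + t) (x - y)).
Proof.
move=> s0 t0; rewrite heat_kernel_prod ?addr_gt0//.
have H i := heat1_chapman_kolmogorov ((x - y) ord0 i + y ord0 i) (y ord0 i) s0 t0.
have := isint_prod_coord H; rewrite [X in isint _ _ X](_ : _ = \prod_i heat1 (s + t) ((x - y) ord0 i)).
  apply: isint_ext => z; rewrite big_split/= !heat_kernel_prod//.
  by congr (_ * _); apply: eq_bigr => i _; rewrite !mxE ?subrK.
by apply: eq_bigr => i _; rewrite addrK.
Qed.

Lemma prod_pow_delta (w : 'I_n -> R) i k : \prod_l w l ^+ (k * (l == i)) = w i ^+ k.
Proof.
rewrite (bigD1 i)//= eqxx muln1 big1 ?mulr1// => l /negbTE ->.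
by rewrite muln0.
Qed.

Lemma isint_heat_pow h x i k m : 0 < h ->
  isint leb (fun b => (b - x ord0 i) ^+ k * heat1 h (b - x ord0 i)) m ->
  isint mu (fun y => heat_kernel h (x - y) * (y - x) ord0 i ^+ k) m.
Proof.
move=> h0 hm.
have := @isint_heat_kernel_moment h x (fun l => (k * (l == i))%N) (fun l => if l == i then m else 1) h0.
rewrite (bigD1 i)//= eqxx big1 ?mulr1; last by move=> l /negbTE ->.
move=> H; apply: isint_ext (H _) => [y|l]; first by rewrite prod_pow_delta.
have [->|_] := eqVneq l i; first by rewrite muln1.
by apply: isint_ext (isint_heat1 _ h0) => b; rewrite muln0 expr0 mul1r.
Qed.

Lemma isint_heat_cross h x i j : 0 < h -> i != j ->
  isint mu (fun y => heat_kernel h (x - y) * ((y - x) ord0 i * (y - x) ord0 j)) 0.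
Proof.
move=> h0 ij.
have := @isint_heat_kernel_moment h x (fun l => (1 * (l == i) + 1 * (l == j))%N)
  (fun l => if (l == i) || (l == j) then 0 else 1) h0.
rewrite (bigD1 i)//= eqxx mul0r => H; apply: isint_ext (H _) => [y|l].
  congr (_ * _); under eq_bigr do rewrite exprD.
  by rewrite big_split/= !prod_pow_delta !expr1.
have [->|li] := eqVneq l i; first by rewrite (negbTE ij); exact: isint_moment1.
have [_|_] := eqVneq l j; first exact: isint_moment1.
by apply: isint_ext (isint_heat1 _ h0) => b; rewrite /= expr0 mul1r.
Qed.

(** The Gaussian average of a quartic polynomial without cubic and mixed
quartic terms: odd moments and correlations vanish, second moments are [2 h]
and fourth moments are [12 h^2]. *)
Lemma isint_heat_quartic h x c (a q : 'I_n -> R) (B : 'I_n -> 'I_n -> R) : 0 < h ->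
  isint mu (fun y => heat_kernel h (x - y) *
    (c + \sum_i a i * (y - x) ord0 i +
     \sum_i \sum_j B i j * ((y - x) ord0 i * (y - x) ord0 j) +
     \sum_i q i * (y - x) ord0 i ^+ 4))
  (c + 2 * h * \sum_i B i i + 12 * h ^+ 2 * \sum_i q i).
Proof.
move=> h0; have H0 := isintZ c (isint_heat_kernel x h0).
have H1 i := isintZ (a i) (isint_heat_pow h0 (isint_moment1 (x ord0 i) h0)).
have H2 i j : isint mu (fun y => B i j * (heat_kernel h (x - y) * ((y - x) ord0 i * (y - x) ord0 j)))
    (if i == j then 2 * h * B i j else 0).
  have [->|ij] := eqVneq i j; last by have := isintZ (B i j) (isint_heat_cross x h0 ij); rewrite mulr0.
  rewrite mulrC; apply: isint_ext (isintZ (B j j) (isint_heat_pow h0 (isint_moment2 (x ord0 j) h0))) => y.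
  by rewrite expr2.
have H4 i := isintZ (q i) (isint_heat_pow h0 (isint_moment4 (x ord0 i) h0)).
have := isintD (isintD (isintD H0 (isint_sum (index_enum _) H1))
  (isint_sum (index_enum _) (fun i => isint_sum (index_enum _) (H2 i)))) (isint_sum (index_enum _) H4).
rewrite [X in isint _ _ X -> _](_ : _ = c + 2 * h * \sum_i B i i + 12 * h ^+ 2 * \sum_i q i).
  apply: isint_ext => y; rewrite !mulrDr; congr (_ + _ + _ + _).
  - by rewrite mulrC.
  - by rewrite mulr_sumr; apply: eq_bigr => i _; rewrite expr1 mulrCA.
  - rewrite mulr_sumr; apply: eq_bigr => i _; rewrite mulr_sumr.
    by apply: eq_bigr => j _; rewrite mulrCA.
  - by rewrite mulr_sumr; apply: eq_bigr => i _; rewrite mulrCA.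
congr (_ + _ + _).
- by rewrite mulr1 big1 ?addr0// => i _; rewrite mulr0.
- rewrite mulr_sumr; apply: eq_bigr => i _.
  by rewrite (bigD1 i)//= eqxx big1 ?addr0// => j; rewrite eq_sym => /negbTE ->.
- by rewrite mulr_sumr; apply: eq_bigr => i _; rewrite mulrC.
Qed.

Lemma continuous_heat_kernel_time (z : 'rV[R]_n) (t : R) : 0 < t ->
  {for t, continuous (fun t => heat_kernel t z)}.
Proof.
move=> t0; have p0 : 0 < 4 * pi * t by rewrite !mulr_gt0 ?pi_gt0.
have c1 : {for t, continuous (fun t : R => 4 * pi * t)} by exact: mulrl_continuous.
have c2 : {for 4 * pi * t, continuous (fun a => a `^ (- (n%:R / 2)))}.
  by apply/differentiable_continuous/derivable1_diffP/derivable_powR; rewrite in_itv/= p0.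
apply: cvgM; first exact: (continuous_comp c1 c2).
apply: (@continuous_comp _ _ _ (fun t : R => - (enorm z ^+ 2 / (4 * t))) expR); last exact: continuous_expR.
apply: cvgN; apply: cvgM; first exact: cvg_cst.
apply: cvgV; first by rewrite gt_eqF// mulr_gt0.
exact: mulrl_continuous.
Qed.

(** Provides one integrable bound for all times in a compact interval. *)
Lemma heat_kernel_le_later (s t v : R) (z : 'rV[R]_n) : 0 < s -> s <= t -> t <= v ->
  heat_kernel t z <= (4 * pi * s) `^ (- (n%:R / 2)) / (4 * pi * v) `^ (- (n%:R / 2)) * heat_kernel v z.
Proof.
move=> s0 st tv; have t0 : 0 < t by lra.
have v0 : 0 < v by lra.
have p0 : 0 < 4 * pi :> R by rewrite mulr_gt0 ?pi_gt0.
rewrite /heat_kernel mulrA divfK ?gt_eqF ?powR_gt0 ?mulr_gt0 ?pi_gt0//.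
apply: ler_pM; rewrite ?powR_ge0 ?expR_ge0//.
  rewrite !powRN lef_pV2 ?posrE ?powR_gt0 ?mulr_gt0 ?pi_gt0//.
  rewrite ge0_ler_powR ?nnegrE ?divr_ge0 ?mulr_ge0 ?pi_ge0 ?(ltW s0) ?(ltW t0)//.
  by rewrite ler_pM2l.
rewrite ler_expR lerN2 ler_wpM2l ?sqr_ge0// lef_pV2 ?posrE ?mulr_gt0//.
by rewrite ler_pM2l.
Qed.

End heat_kernel.

(** * The heat semigroup *)

(* From here on the kernel is used through its lemmas: letting unification
   unfold the product that defines it makes rewriting very slow. *)
#[local] Opaque heat_kernel.

Section semigroup.
Variables (R : realType) (n : nat).
Implicit Types (h s t M : R) (x y z : 'rV[R]_n) (f g : 'rV[R]_n -> R).

Local Notation mu := (lebesgue_rV R n).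

(** The class of functions on which the semigroup is studied: it is invariant
under the semigroup and Tonelli's theorem applies to it. *)
Definition bounded_ge0 M f := measurable_fun setT f /\ forall x, 0 <= f x <= M.

Lemma measurable_rV_sub :
  measurable_fun setT (fun z : 'rV[R]_n * 'rV[R]_n => z.1 - z.2).
Proof.
apply: measurable_rVP => i; rewrite (_ : (fun _ => _) =
  fun z : 'rV[R]_n * 'rV[R]_n => z.1 ord0 i - z.2 ord0 i); last first.
  by apply/funext => z; rewrite !mxE.
apply: measurable_funB.
  exact: (measurableT_comp (measurable_rV_coord i) measurable_fst).
exact: (measurableT_comp (measurable_rV_coord i) measurable_snd).
Qed.

Lemma measurable_heat_kernel_sub h :
  measurable_fun setT (fun z : 'rV[R]_n * 'rV[R]_n => heat_kernel h (z.1 - z.2)).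
Proof. exact: (measurableT_comp (measurable_heat_kernel h) measurable_rV_sub). Qed.

Lemma measurable_heat_kernel_subl h x :
  measurable_fun setT (fun y : 'rV[R]_n => heat_kernel h (x - y)).
Proof.
exact: (measurableT_comp (measurable_heat_kernel_sub h) (measurable_pair1 x)).
Qed.

Lemma isint_heat_semigroup h M f x : 0 < h -> measurable_fun setT f ->
  (forall y, `|f y| <= M) ->
  isint mu (fun y => heat_kernel h (x - y) * f y) (heat_semigroup h f x).
Proof.
move=> h0 mf fM; apply: isint_integrable.
have [hi _] := isintZ M (isint_heat_kernel x h0).
apply: le_integrable hi => //.
  apply/measurable_EFinP; apply: measurable_funM => //; exact: measurable_heat_kernel_subl.
move=> y _ /=; rewrite lee_fin normrM mulrC (normrM M).
apply: ler_wpM2r => //; exact: le_trans (fM y) (ler_norm _).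
Qed.

Lemma isint_heat_semigroup_ge0 h M f x : 0 < h -> bounded_ge0 M f ->
  isint mu (fun y => heat_kernel h (x - y) * f y) (heat_semigroup h f x).
Proof.
move=> h0 [mf fM]; apply: (isint_heat_semigroup (M := M)) => // y.
by have /andP[f0 fy] := fM y; rewrite ger0_norm.
Qed.

Lemma le_heat_semigroup h M M' f g x : 0 < h -> bounded_ge0 M f -> bounded_ge0 M' g ->
  (forall y, f y <= g y) -> heat_semigroup h f x <= heat_semigroup h g x.
Proof.
move=> h0 bf bg fg.
apply: isint_le (isint_heat_semigroup_ge0 x h0 bf) (isint_heat_semigroup_ge0 x h0 bg) _ => y.
by rewrite ler_wpM2l// heat_kernel_ge0.
Qed.

Lemma heat_semigroup_bounds h M f x : 0 < h -> bounded_ge0 M f ->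
  0 <= heat_semigroup h f x <= M.
Proof.
move=> h0 bf; apply/andP; split.
  apply: Rintegral_ge0 => y _; have [_ /(_ y)/andP[f0 _]] := bf.
  by rewrite mulr_ge0// heat_kernel_ge0.
rewrite -[leRHS]mulr1.
apply: isint_le (isint_heat_semigroup_ge0 x h0 bf) (isintZ M (isint_heat_kernel x h0)) _ => y.
have [_ /(_ y)/andP[_ fM]] := bf.
by rewrite mulrC ler_wpM2r// heat_kernel_ge0.
Qed.

Lemma measurable_heat_semigroup h M f : 0 < h -> bounded_ge0 M f ->
  measurable_fun setT (heat_semigroup h f).
Proof.
move=> h0 bf; have [mf fM] := bf; apply/measurable_EFinP.
pose F (z : 'rV[R]_n * 'rV[R]_n) := (heat_kernel h (z.1 - z.2) * f z.2)%:E.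
have mF : measurable_fun setT F.
  apply/measurable_EFinP; apply: measurable_funM; first exact: measurable_heat_kernel_sub.
  exact: measurableT_comp measurable_snd.
have F0 (z : 'rV[R]_n * 'rV[R]_n) : (0 <= F z)%E.
  by rewrite lee_fin mulr_ge0 ?heat_kernel_ge0//; case/andP: (fM z.2).
have := measurable_fun_fubini_tonelli_F (m2 := mu) F mF F0.
rewrite /fubini_F; congr measurable_fun; apply/funext => x /=.
by rewrite -(isint_heat_semigroup_ge0 x h0 bf).2.
Qed.

Lemma bounded_ge0_heat_semigroup h M f : 0 < h -> bounded_ge0 M f ->
  bounded_ge0 M (heat_semigroup h f).
Proof.
move=> h0 bf; split; first exact: measurable_heat_semigroup bf.
by move=> x; exact: heat_semigroup_bounds.
Qed.

(** Tonelli and the Chapman-Kolmogorov identity for the kernel. *)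
Lemma heat_semigroupD s t M f x : 0 < s -> 0 < t -> bounded_ge0 M f ->
  heat_semigroup (s + t) f x = heat_semigroup s (heat_semigroup t f) x.
Proof.
move=> s0 t0 bf; have [mf fM] := bf; apply: EFin_inj.
have st0 : 0 < s + t by rewrite addr_gt0.
have f0 y : 0 <= f y by case/andP: (fM y).
rewrite -(isint_heat_semigroup_ge0 x st0 bf).2.
rewrite -(isint_heat_semigroup_ge0 x s0 (bounded_ge0_heat_semigroup t0 bf)).2.
pose F (z : 'rV[R]_n * 'rV[R]_n) :=
  (heat_kernel s (x - z.1) * (heat_kernel t (z.1 - z.2) * f z.2))%:E.
have mF : measurable_fun setT F.
  apply/measurable_EFinP; apply: measurable_funM.
    exact: (measurableT_comp (measurable_heat_kernel_subl s x) measurable_fst).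
  apply: measurable_funM; first exact: measurable_heat_kernel_sub.
  exact: measurableT_comp measurable_snd.
have F0 (z : 'rV[R]_n * 'rV[R]_n) : (0 <= F z)%E by rewrite /F lee_fin mulr_ge0 ?heat_kernel_ge0// mulr_ge0 ?heat_kernel_ge0.
have := fubini_tonelli (m1 := mu) (m2 := mu) F mF F0; rewrite /F /= => E.
transitivity (\int[mu]_y \int[mu]_z
    (heat_kernel s (x - z) * (heat_kernel t (z - y) * f y))%:E)%E.
  apply: eq_integral => y _.
  have [_] := isintZ (f y) (heat_kernel_chapman_kolmogorov x y s0 t0).
  by rewrite (mulrC (f y) (heat_kernel (s + t) _)) => <-; apply: eq_integral => z _; congr EFin; ring.
rewrite -E; apply: eq_integral => z _.
have [_] := isintZ (heat_kernel s (x - z)) (isint_heat_semigroup_ge0 z t0 bf).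
by move=> <-.
Qed.

End semigroup.

(** * Quartic minorants from Taylor's formula *)

Section taylor.
Variables (R : realType) (n : nat).
Implicit Types (x y w : 'rV[R]_n) (f : 'rV[R]_n -> R).

(** The mean value theorem, applied to the derivative of [g] and then to the
remainder [g s - g1 0 * s - m / 2 * s ^+ 2]. *)
Lemma taylor2_ge (g g1 g2 : R -> R) m :
  (forall s : R, 0 <= s <= 1 -> is_derive s 1 g (g1 s)) ->
  (forall s : R, 0 <= s <= 1 -> is_derive s 1 g1 (g2 s)) ->
  (forall s : R, 0 <= s <= 1 -> m <= g2 s) ->
  g 0 + g1 0 + m / 2 <= g 1.
Proof.
move=> dg dg1 mg2.
have mvt (k k1 : R -> R) (s : R) : 0 < s <= 1 ->
    (forall s : R, 0 <= s <= 1 -> is_derive s 1 k (k1 s)) ->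
    exists2 c : R, 0 <= c <= 1 & k s - k 0 = k1 c * s.
  move=> /andP[s0 s1] dk; have [||c] := @MVT R k k1 0 s s0.
  - by move=> c /[!in_itv]/= /andP[c0 cs]; apply: dk; lra.
  - apply: derivable_within_continuous => c /[!in_itv]/= /andP[c0 cs].
    by have [|//] := dk c; lra.
  - rewrite in_itv/= subr0 => /andP[c0 cs] E; exists c => //; lra.
have key s : 0 <= s <= 1 -> 0 <= g1 s - g1 0 - m * s.
  move=> /andP[]; rewrite le_eqVlt => /predU1P[<- _|s0 s1].
    by rewrite mulr0; lra.
  have [|c c01 ->] := mvt g1 g2 s _ dg1; first by rewrite s0.
  by rewrite -mulrBl mulr_ge0 ?subr_ge0 ?(ltW s0)// mg2.
have [||c c01] := mvt (fun s => g s - g1 0 * s - m / 2 * s ^+ 2) (fun s => g1 s - g1 0 - m * s) 1.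
- by rewrite ltr01 lexx.
- move=> s s01; have := dg s s01 => ?; apply: is_derive_eq.
  by rewrite /GRing.scale /=; lra.
- by have := key c c01; lra.
Qed.

Lemma is_derive_line f x w (s : R) : derivable f (x + s *: w) w ->
  is_derive s 1 (fun s => f (x + s *: w)) ('D_w f (x + s *: w)).
Proof.
move=> df.
have E : (fun h : R => h^-1 *: (f (x + (h *: 1 + s) *: w) - f (x + s *: w))) =
         (fun h : R => h^-1 *: (f (h *: w + (x + s *: w)) - f (x + s *: w))).
  apply/funext => h; congr (_ *: (f _ - _)).
  by rewrite scalerDl addrCA /GRing.scale /= mulr1.
split; first by rewrite /derivable /= E.
by rewrite /derive /= E.
Qed.

(** Links directional derivatives to the partial derivatives in which the
Laplacian is written. *)
Lemma derive_partialE f x w : differentiable f x ->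
  'D_w f x = \sum_i w ord0 i * partial i f x.
Proof.
move=> df; rewrite deriveE// {1}(row_sum_delta w) linear_sum.
by apply: eq_bigr => i _; rewrite linearZ /= /partial deriveE.
Qed.

Lemma is_derive_line_partial f x w (s : R) : differentiable f (x + s *: w) ->
  is_derive s 1 (fun s => f (x + s *: w)) (\sum_i w ord0 i * partial i f (x + s *: w)).
Proof.
move=> df; rewrite -derive_partialE//.
exact: (is_derive_line (diff_derivable df)).
Qed.

(** From [|w_i w_j| <= (w_i^2 + w_j^2) / 2]. *)
Lemma quadratic_form_ge (w : 'I_n -> R) (E : 'I_n -> 'I_n -> R) e : 0 <= e ->
  (forall i j, `|E i j| <= e) ->
  - (e * n%:R * \sum_i w i ^+ 2) <= \sum_i \sum_j E i j * (w i * w j).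
Proof.
move=> e0 Ee.
have -> : e * n%:R * \sum_i w i ^+ 2 =
    \sum_i \sum_j e * ((w i ^+ 2 + w j ^+ 2) / 2).
  transitivity (\sum_i (e * n%:R * (w i ^+ 2 / 2) + e * ((\sum_j w j ^+ 2) / 2))).
    rewrite big_split/= -mulr_sumr -mulr_suml sumr_const card_ord -mulr_natr.
    by field.
  apply: eq_bigr => i _; rewrite -mulr_sumr -mulr_suml big_split/= sumr_const card_ord -mulr_natr.
  by field.
rewrite -sumrN ler_sum// => i _; rewrite -sumrN ler_sum// => j _.
have wij : `|w i * w j| <= (w i ^+ 2 + w j ^+ 2) / 2.
  rewrite ler_norml; apply/andP; split.
    by have := sqr_ge0 (w i + w j); lra.
  by have := sqr_ge0 (w i - w j); lra.
rewrite lerNl (le_trans (ler_norm _))// normrN normrM.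
by rewrite ler_pM.
Qed.

(** The second derivatives are frozen at [x], and their oscillation near [x]
is absorbed in [eta |w|^2]. What matters is that [delta] serves all base
points [y] near [x] at once. *)
Lemma local_taylor_ge f x eta : 0 < eta ->
  (\forall y \near x, differentiable f y /\ forall i, differentiable (partial i f) y) ->
  (forall i j, {for x, continuous (partial j (partial i f))}) ->
  exists2 delta, 0 < delta & forall y w, `|x - y| < delta -> `|w| < delta ->
    f y + \sum_i partial i f y * w ord0 i +
    \sum_i \sum_j 2^-1 * partial j (partial i f) x * (w ord0 i * w ord0 j) -
    eta * \sum_i w ord0 i ^+ 2 <= f (y + w).
Proof.
move=> eta0 df cf; pose eta1 := 2 * eta / n.+1%:R.
have eta10 : 0 < eta1 by rewrite divr_gt0// mulr_gt0.
have cf1 : \forall y \near x, forall i j,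
    `|partial j (partial i f) x - partial j (partial i f) y| <= eta1.
  have H i j : \forall y \near x, `|partial j (partial i f) x - partial j (partial i f) y| <= eta1.
    by have /cvgrPdist_le := cf i j; exact.
  exact: (filter_forall (nbhs_filter x) (fun i => filter_forall (nbhs_filter x) (H i))).
have /nbhs_ballP[d /= d0 dP] := @filterI _ _ (nbhs_filter x) _ _ df cf1.
(* Both y and the whole segment from y to y + w stay in the ball of radius d. *)
exists (d / 2) => [|y w xy wd]; first by rewrite divr_gt0.
have near (s : R) : 0 <= s <= 1 -> ball x d (y + s *: w).
  move=> /andP[s0 s1]; rewrite mx_norm_ball /ball_/=.
  rewrite opprD addrA (le_lt_trans (ler_normB _ _))//.
  rewrite normrZ (ger0_norm s0) [ltRHS]splitr ltr_leD//.
  by rewrite (le_trans _ (ltW wd))// ler_piMl.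
have D (s : R) : 0 <= s <= 1 -> is_derive s 1 (fun s : R => f (y + s *: w))
    (\sum_i w ord0 i * partial i f (y + s *: w)).
  by move=> /near/dP[[dfs _] _]; exact: is_derive_line_partial.
have D2 (s : R) : 0 <= s <= 1 ->
    is_derive s 1 (fun s : R => \sum_i w ord0 i * partial i f (y + s *: w))
      (\sum_i w ord0 i * \sum_j w ord0 j * partial j (partial i f) (y + s *: w)).
  move=> /near/dP[[_ dfs] _].
  have H i : is_derive s 1 (w ord0 i *: (fun s : R => partial i f (y + s *: w)))
      (w ord0 i *: \sum_j w ord0 j * partial j (partial i f) (y + s *: w)).
    exact: (is_deriveZ (w ord0 i) (is_derive_line_partial (dfs i))).
  by have := is_derive_sum H; rewrite fct_sumE.
pose m := \sum_i \sum_j partial j (partial i f) x * (w ord0 i * w ord0 j) -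
  2 * eta * \sum_i w ord0 i ^+ 2.
have recenter (a b c e : R) : a * (b * c) = (c - e) * (a * b) + e * (a * b) by ring.
have mg (s : R) : 0 <= s <= 1 -> m <=
    \sum_i w ord0 i * \sum_j w ord0 j * partial j (partial i f) (y + s *: w).
  move=> /near/dP[_ dfs]; rewrite /m -subr_ge0.
  have := @quadratic_form_ge (fun i => w ord0 i) (fun i j => partial j (partial i f) (y + s *: w)
    - partial j (partial i f) x) eta1.
  move=> /(_ (ltW eta10) (fun i j => _)) q.
  have {}q := q (fun i j => (eq_ind_r (fun z => z <= eta1) (dfs i j) (distrC _ _))).
  have nw : eta1 * n%:R * \sum_i w ord0 i ^+ 2 <= 2 * eta * \sum_i w ord0 i ^+ 2.
    rewrite ler_wpM2r ?sumr_ge0// => [i _|]; first exact: sqr_ge0.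
    by rewrite mulrAC ler_pdivrMr// ler_pM2l ?mulr_gt0// ler_nat.
  rewrite (_ : \sum_i w ord0 i * _ = \sum_i \sum_j (partial j (partial i f) (y + s *: w)
    - partial j (partial i f) x) * (w ord0 i * w ord0 j) +
    \sum_i \sum_j partial j (partial i f) x * (w ord0 i * w ord0 j)).
    by rewrite opprB addrACA subrr addr0 -lerBlDr sub0r; apply: le_trans q; rewrite lerN2.
  rewrite -big_split; apply: eq_bigr => i _; rewrite mulr_sumr -big_split.
  by apply: eq_bigr => j _; exact: recenter.
have half1 (a b : R) : 2^-1 * a * b = a * b / 2 by ring.
have half2 (a b : R) : 2 * a * b / 2 = a * b by field.
have := taylor2_ge D D2 mg.
rewrite scale0r addr0 scale1r /m; apply: le_trans; rewrite -addrA.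
apply: lerD.
  by rewrite lerD2l ler_sum// => i _; rewrite mulrC.
rewrite mulrBl lerB//.
  rewrite mulr_suml ler_sum// => i _; rewrite mulr_suml ler_sum// => j _.
  by rewrite half1.
by rewrite half2.
Qed.

Lemma coord_le_norm w i : `|w ord0 i| <= `|w|.
Proof.
rewrite [leRHS]mx_normrE; apply/bigmax_geP; right.
by exists (ord0, i).
Qed.

Lemma norm_pow4_le w : `|w| ^+ 4 <= \sum_i w ord0 i ^+ 4.
Proof.
have [/eqP w0|w0] := boolP (`|w| == 0).
  by rewrite w0 expr0n/= sumr_ge0// => i _; rewrite exprn_even_ge0.
have [[i j] /= wE] := mx_norm_neq0 w0.
rewrite [X in X ^+ 4]wE (ord1 i) (bigD1 j)//= -normrX ger0_norm ?exprn_even_ge0// lerDl.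
by rewrite sumr_ge0// => k _; rewrite exprn_even_ge0.
Qed.

(** Away from the origin a quadratic polynomial is dominated by a multiple of
[\sum_i w_i^4], since the sup norm satisfies [|w|^4 <= \sum_i w_i^4]. *)
Lemma quartic_far (c : R) (a : 'I_n -> R) (B : 'I_n -> 'I_n -> R) (A delta : R) w :
  0 < delta <= 1 -> `|c| <= A -> (forall i, `|a i| <= A) ->
  (forall i j, `|B i j| <= A) -> delta <= `|w| ->
  c + \sum_i a i * w ord0 i + \sum_i \sum_j B i j * (w ord0 i * w ord0 j) <=
  A * (1 + n%:R + n%:R ^+ 2) / delta ^+ 4 * \sum_i w ord0 i ^+ 4.
Proof.
move=> /andP[d0 d1] cA aA BA dw; set m := `|w| in dw *.
have A0 : 0 <= A := le_trans (normr_ge0 _) cA.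
have m0 : 0 < m by apply: lt_le_trans dw.
have d40 : 0 < delta ^+ 4 by rewrite exprn_gt0.
pose K := A * (1 + n%:R + n%:R ^+ 2).
have K0 : 0 <= K by rewrite mulr_ge0// !addr_ge0// exprn_ge0.
apply: (@le_trans _ _ (K / delta ^+ 4 * m ^+ 4)); last first.
  by rewrite ler_wpM2l ?norm_pow4_le// divr_ge0// ltW.
pose q := m / delta.
have q1 : 1 <= q by rewrite ler_pdivlMr// mul1r.
have mq : m <= q by rewrite ler_pdivlMr// ler_piMr// ltW.
have qE : m ^+ 4 / delta ^+ 4 = q ^+ 4 by rewrite /q expr_div_n.
have md : 1 <= m ^+ 4 / delta ^+ 4 by rewrite qE exprn_ege1.
have md1 : m <= m ^+ 4 / delta ^+ 4.
  by rewrite qE (le_trans mq)// -[leLHS]expr1 ler_weXn2l.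
have md2 : m ^+ 2 <= m ^+ 4 / delta ^+ 4.
  rewrite qE (@le_trans _ _ (q ^+ 2))// ?ler_weXn2l//.
  by rewrite lerXn2r ?nnegrE ?(ltW m0)// (le_trans _ q1).
have wm i : `|w ord0 i| <= m := coord_le_norm w i.
have s1 : \sum_i a i * w ord0 i <= A * n%:R * m.
  apply: (@le_trans _ _ (\sum_(i < n) A * m)).
    apply: ler_sum => i _; rewrite (le_trans (ler_norm _))// normrM.
    by rewrite ler_pM.
  by rewrite sumr_const card_ord -(mulr_natr (A * m)) mulrAC.
have s2 : \sum_i \sum_j B i j * (w ord0 i * w ord0 j) <= A * n%:R ^+ 2 * m ^+ 2.
  apply: (@le_trans _ _ (\sum_(i < n) \sum_(j < n) A * (m * m))).
    apply: ler_sum => i _; apply: ler_sum => j _.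
    rewrite (le_trans (ler_norm _))// !normrM.
    by rewrite ler_pM// ?mulr_ge0// ler_pM.
  rewrite !sumr_const card_ord -(mulr_natr (A * (m * m))) -(mulr_natr (_ * n%:R)).
  by rewrite !expr2 [leLHS](_ : _ = A * (n%:R * n%:R) * (m * m))//; ring.
have An : 0 <= A * n%:R by rewrite mulr_ge0.
have An2 : 0 <= A * n%:R ^+ 2 by rewrite mulr_ge0// exprn_ge0.
have c1 : c <= A by rewrite (le_trans (ler_norm _)).
have := ler_wpM2l A0 md; have := ler_wpM2l An md1; have := ler_wpM2l An2 md2.
rewrite mulr1 (_ : K / delta ^+ 4 * m ^+ 4 = A * (m ^+ 4 / delta ^+ 4) + A * n%:R * (m ^+ 4 / delta ^+ 4) + A * n%:R ^+ 2 * (m ^+ 4 / delta ^+ 4)); last by rewrite /K; ring.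
move=> h2 h1 h0.
apply: lerD; first apply: lerD.
- exact: le_trans c1 h0.
- exact: le_trans s1 h1.
- exact: le_trans s2 h2.
Qed.

Lemma le_sum_term (g : 'I_n -> R) i : (forall k, 0 <= g k) -> g i <= \sum_k g k.
Proof. by move=> g0; rewrite (bigD1 i)//= lerDl sumr_ge0. Qed.

(** Near the base point this is Taylor's formula; far from it the quartic term
makes the left-hand side nonpositive, and the truncation is nonnegative. The
constant [C] is uniform for [y] near [x], as required by the later compactness
argument. *)
Lemma quartic_minorant f x (eps M eta : R) : 0 < eta ->
  (forall y, `|f y - eps| <= M) ->
  (\forall y \near x, differentiable f y /\ forall i, differentiable (partial i f) y) ->
  (forall i j, {for x, continuous (partial j (partial i f))}) ->
  exists C, \forall y \near x, forall w,
    f y - eps + \sum_i partial i f y * w ord0 i +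
    \sum_i \sum_j 2^-1 * partial j (partial i f) x * (w ord0 i * w ord0 j) -
    eta * \sum_i w ord0 i ^+ 2 - C * \sum_i w ord0 i ^+ 4 <= Num.max (f (y + w) - eps) 0.
Proof.
move=> eta0 fM df cf.
have [delta' delta'0 loc] := local_taylor_ge eta0 df cf.
pose delta := Num.min delta' 1.
have delta01 : 0 < delta <= 1 by rewrite lt_min delta'0 ltr01 ge_min lexx orbT.
pose G : R := \sum_i (`|partial i f x| + 1).
pose H : R := \sum_i \sum_j `|2^-1 * partial j (partial i f) x|.
have G0 : 0 <= G by rewrite sumr_ge0// => i _; rewrite addr_ge0.
have H0 : 0 <= H by rewrite sumr_ge0// => i _; rewrite sumr_ge0.
have M0 : 0 <= M := le_trans (normr_ge0 _) (fM x).
pose A : R := M + G + H.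
exists (A * (1 + n%:R + n%:R ^+ 2) / delta ^+ 4).
have nd : \forall y \near x, `|x - y| < delta'.
  by apply: (@cvgr_dist_lt _ _ _ (nbhs x)) => //.
have nG : \forall y \near x, forall i, `|partial i f y| <= G.
  have nGi i : \forall y \near x, `|partial i f y| <= G.
    have cx : {for x, continuous (partial i f)}.
      by apply: differentiable_continuous; exact: (nbhs_singleton df).2.
    have /cvgrPdist_le/(_ 1 ltr01) := cx.
    apply: (@filterS _ _ (nbhs_filter x)) => y h.
    rewrite -(subrK (partial i f x) (partial i f y)) (le_trans (ler_normD _ _))//.
    rewrite addrC /G (bigD1 i)//= -addrA lerD2l distrC -[leLHS]addr0 lerD//.
    by rewrite sumr_ge0// => j _; rewrite addr_ge0.
  exact: (filter_forall (nbhs_filter x) nGi).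
apply: (@filterS2 _ _ (nbhs_filter x) _ _ _ _ nd nG) => y yd yG w.
rewrite le_max; have [wd|wd] := ltP `|w| delta.
  apply/orP; left; have := loc y w yd (lt_le_trans wd _).
  rewrite ge_min lexx => /(_ isT) hloc.
  have C0 : 0 <= A * (1 + n%:R + n%:R ^+ 2) / delta ^+ 4 * \sum_i w ord0 i ^+ 4.
    have [d0 _] := andP delta01.
    rewrite mulr_ge0//; last by rewrite (le_trans _ (norm_pow4_le w))// exprn_ge0.
    by rewrite divr_ge0 ?exprn_ge0 ?(ltW d0)// mulr_ge0 ?addr_ge0// exprn_ge0.
  have arith (a b c d e g k : R) : 0 <= g -> a + b + c - d <= e -> a - k + b + c - d - g <= e - k by lra.
  exact: arith C0 hloc.
apply/orP; right.
have w2 : 0 <= eta * \sum_i w ord0 i ^+ 2.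
  by rewrite mulr_ge0 ?(ltW eta0)// sumr_ge0// => i _; exact: sqr_ge0.
rewrite subr_le0; apply: (@le_trans _ _ (f y - eps + \sum_i partial i f y * w ord0 i +
  \sum_i \sum_j 2^-1 * partial j (partial i f) x * (w ord0 i * w ord0 j))).
  by rewrite gerBl.
apply: (quartic_far delta01 _ _ _ wd).
- by rewrite (le_trans (fM y))// /A -addrA lerDl addr_ge0.
- by move=> i; rewrite (le_trans (yG i))// /A addrAC lerDr addr_ge0.
- move=> i j; rewrite (@le_trans _ _ H)//; last by rewrite /A lerDr addr_ge0.
  apply: (@le_trans _ _ (\sum_j `|2^-1 * partial j (partial i f) x|)).
    by apply: (@le_sum_term (fun j => `|2^-1 * partial j (partial i f) x|) j).
  apply: (@le_sum_term (fun i => \sum_j `|2^-1 * partial j (partial i f) x|) i) => k.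
  by rewrite sumr_ge0.
Qed.

End taylor.

(** * Subsolutions under the heat semigroup *)

Section subsolution.
Variables (R : realType) (n : nat) (psi : 'rV[R]_n -> R) (m M : R).
Hypotheses (m0 : 0 <= m) (psiM : forall x, 0 <= psi x <= M) (cpsi : continuous psi).
Hypothesis psi_C2 : forall x, 0 < psi x ->
  [/\ differentiable psi x,
      forall i, differentiable (partial i psi) x &
      forall i j, {for x, continuous (partial j (partial i psi))}].
Hypothesis psi_sub : forall x, 0 < psi x -> - laplacian psi x <= m * psi x.
Hypothesis psi_compact : forall eps : R, 0 < eps -> compact [set x | eps <= psi x].
Implicit Types (eps rho h t : R) (x y z w : 'rV[R]_n).

(** Truncating at height [eps] confines the region where second derivatives
are needed to a compact subset of the open ball. *)
Definition truncation eps rho x : R := Num.max (psi (rho *: x) - eps) 0.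

Lemma bounded_truncation eps rho : 0 <= eps -> bounded_ge0 M (truncation eps rho).
Proof.
move=> eps0; split.
  apply: measurable_maxr => //; apply: measurable_funB => //.
  apply: continuous_measurable_rV => x.
  apply: (@continuous_comp _ _ _ (fun x => rho *: x) psi); last exact: cpsi.
  exact: scaler_continuous.
move=> x; rewrite le_max lexx orbT/= ge_max.
have /andP[p0 pM] := psiM (rho *: x).
by rewrite (le_trans p0 pM) andbT lerBlDr (le_trans pM)// lerDl.
Qed.

Lemma expRN_le (s : R) : 0 <= s -> expR (- s) <= 1 - s + s ^+ 2.
Proof.
move=> s0; rewrite expRN; apply: (@le_trans _ _ (1 + s)^-1).
  by rewrite lef_pV2 ?posrE ?expR_gt0 ?ltr_pwDl// expR_ge1Dx.
rewrite -div1r ler_pdivrMr ?ltr_pwDl//.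
have : 0 <= s * s ^+ 2 by rewrite mulr_ge0// sqr_ge0.
by nra.
Qed.

(** Average the quartic minorant of [psi - eps] against the kernel at time [h].
Its second-order part gives [h rho^2 laplacian psi(x) >= - m h rho^2 psi(x)],
hence the exponential factor up to [O(h^2)]; the error terms are [O(eta h)] and
[O(h^2)], and [eta] of order [eps] makes their sum at most [O(eps h)]. *)
Lemma heat_truncation_one_step eps rho x : 0 < eps -> 0 < rho -> eps <= psi x ->
  \forall y \near x & h \near 0^'+, forall z, rho *: z = y ->
    expR (- (m * rho ^+ 2 * h)) * truncation eps rho z - (m * rho ^+ 2 + 1) * eps * h <=
    heat_semigroup h (truncation eps rho) z.
Proof.
move=> eps0 rho0 xeps.
have psix : 0 < psi x by exact: lt_le_trans xeps.
(* The error linear in h is rho^2 (m + 2 n) eta h: m eta comes from comparing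
   psi x with psi y, and 2 n eta from the second moments; this eta makes it at
   most eps h / 2. *)
pose eta := eps / (2 * (rho ^+ 2 * (m + 2 * n%:R) + 1)).
have r0 : 0 <= rho ^+ 2 * (m + 2 * n%:R) by rewrite mulr_ge0 ?sqr_ge0 ?addr_ge0 ?mulr_ge0.
have eta0 : 0 < eta by rewrite divr_gt0// mulr_gt0// ltr_wpDl.
have etaE : rho ^+ 2 * (m + 2 * n%:R) * eta <= eps / 2.
  rewrite /eta; set r := rho ^+ 2 * _ in r0 *.
  rewrite mulrA ler_pdivrMr ?mulr_gt0 ?ltr_wpDl//.
  rewrite [leRHS](_ : _ = r * eps + eps); last by field.
  by rewrite lerDl ltW.
have M0 : 0 <= M by have /andP[] := psiM x; exact: le_trans.
have psiB y : `|psi y - eps| <= M + eps.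
  have /andP[p0 pM] := psiM y.
  by rewrite ler_norml; lra.
have nC2 : \forall y \near x, differentiable psi y /\ forall i, differentiable (partial i psi) y.
  have /cvgrPdist_lt/(_ _ psix) := @cpsi x.
  apply: (@filterS _ _ (nbhs_filter x)) => y xy.
  suff /psi_C2[] : 0 < psi y by [].
  by move: xy; rewrite ltr_norml; lra.
have [_ _ c2x] := psi_C2 psix.
have [C nC] := quartic_minorant eta0 psiB nC2 c2x.
have nclose : \forall y \near x, psi x <= psi y + eta.
  have /cvgrPdist_le/(_ eta eta0) := @cpsi x.
  apply: (@filterS _ _ (nbhs_filter x)) => y.
  by rewrite ler_norml; lra.
(* The coefficient of h^2: fourth moments and the quadratic error of the
   exponential. The condition h D <= eps / 2 makes it at most eps h / 2. *)
pose D := 12 * n%:R * `|C| * rho ^+ 4 + m ^+ 2 * rho ^+ 4 * M.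
have D0 : 0 <= D by rewrite addr_ge0// !mulr_ge0 ?exprn_ge0 ?(ltW rho0).
have nh : \forall h \near 0^'+, (0 < h) && (h * D <= eps / 2).
  have H0 : 0 < eps / 2 / (D + 1) by rewrite !divr_gt0// ltr_wpDl.
  near=> h; apply/andP; split; first by near: h; exact: nbhs_right_gt.
  have : h <= eps / 2 / (D + 1) by near: h; exact: nbhs_right_le.
  rewrite ler_pdivlMr ?ltr_wpDl// => hD; apply: le_trans hD.
  by rewrite ler_wpM2l ?lerDl// ltW//; near: h; exact: nbhs_right_gt.
near=> y h => /= z zy.
have /andP[h0 hD] : (0 < h) && (h * D <= eps / 2) by near: h.
have bF := bounded_truncation rho (ltW eps0).
have hr0 : 0 <= h * rho ^+ 2 by rewrite mulr_ge0 ?sqr_ge0 ?(ltW h0).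
have mrh : 0 <= m * rho ^+ 2 * h by rewrite -mulrA (mulrC (_ ^+ _)) mulr_ge0.
have [yeps|yeps] := ltP (psi y) eps.
  have /andP[F0 _] := heat_semigroup_bounds z h0 bF.
  rewrite {1}/truncation zy max_r; last by rewrite subr_le0 ltW.
  rewrite mulr0 sub0r (le_trans _ F0)// oppr_le0 !mulr_ge0 ?(ltW eps0) ?(ltW h0)//.
  by rewrite addr_ge0// mulr_ge0// sqr_ge0.
have minor : forall w, psi y - eps + \sum_i partial i psi y * w ord0 i +
    \sum_i \sum_j 2^-1 * partial j (partial i psi) x * (w ord0 i * w ord0 j) -
    eta * \sum_i w ord0 i ^+ 2 - C * \sum_i w ord0 i ^+ 4 <= Num.max (psi (y + w) - eps) 0.
  by near: y.
have xy : psi x <= psi y + eta by near: y.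
have Hq := isint_heat_quartic z (psi y - eps) (fun i => rho * partial i psi y)
  (fun=> - C * rho ^+ 4)
  (fun i j => rho ^+ 2 * (2^-1 * partial j (partial i psi) x - eta * (i == j)%:R)) h0.
apply: (@le_trans _ _ (psi y - eps + h * rho ^+ 2 * laplacian psi x
   - 2 * (h * rho ^+ 2 * n%:R) * eta - 12 * h ^+ 2 * n%:R * C * rho ^+ 4)).
  rewrite {1}/truncation zy max_l ?subr_ge0//.
  have v0 : 0 <= psi y - eps by rewrite subr_ge0.
  have vM : psi y - eps <= M by have := psiB y; have /andP[] := psiM y; lra.
  have h1 := ler_wpM2r v0 (expRN_le mrh).
  have h2 := ler_wpM2l (sqr_ge0 (m * rho ^+ 2 * h)) vM.
  have h3 := ler_wpM2l hr0 (psi_sub psix).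
  have h4 := ler_wpM2l (mulr_ge0 hr0 m0) xy.
  have h5 := ler_wpM2l (ltW h0) etaE.
  have h6 := ler_wpM2l (ltW h0) hD.
  have h7 : h ^+ 2 * n%:R * rho ^+ 4 * C <= h ^+ 2 * n%:R * rho ^+ 4 * `|C|.
    by rewrite ler_wpM2l ?ler_norm// !mulr_ge0 ?exprn_ge0 ?(ltW h0) ?(ltW rho0).
  move: h1 h2 h3 h4 h5 h6 h7; rewrite /D.
  move: (expR _) (laplacian _ _) (psi x) (psi y) `|C| => E L px py aC; clear.
  by lra.
rewrite [leLHS](_ : _ = psi y - eps +
    2 * h * \sum_i rho ^+ 2 * (2^-1 * partial i (partial i psi) x - eta * (i == i)%:R) +
    12 * h ^+ 2 * \sum_(i < n) - C * rho ^+ 4).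
  apply: isint_le Hq (isint_heat_semigroup_ge0 z h0 bF) _ => z'.
  rewrite ler_wpM2l ?heat_kernel_ge0//.
  have := minor (rho *: (z' - z)).
  rewrite -[X in _ <= Num.max (psi X - _) _](_ : rho *: z' = _); last first.
    by rewrite -zy scalerBr addrC subrK.
  apply: le_trans; rewrite le_eqVlt; apply/orP; left; apply/eqP.
  set w := z' - z; rewrite -!addrA; congr (_ + (_ + (_ + _))).
    by apply: eq_bigr => i _; rewrite !mxE; ring.
  rewrite addrA; congr (_ + _); last first.
    by rewrite mulr_sumr -sumrN; apply: eq_bigr => i _; rewrite !mxE; ring.
  rewrite mulr_sumr -sumrB; apply: eq_bigr => i _.
  rewrite [X in _ = _ - X](_ : _ = \sum_j eta * rho ^+ 2 * (i == j)%:R * (w ord0 i * w ord0 j)).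
    rewrite -sumrB; apply: eq_bigr => j _; rewrite !mxE.
    move: (partial _ _ _) => q; ring.
  rewrite (bigD1 i)//= eqxx big1 => [|j]; last by rewrite eq_sym => /negbTE ->; rewrite mulr0 mul0r.
  by rewrite mxE [true%:R]mulr1n; ring.
rewrite sumr_const card_ord -(mulr_natr (- C * rho ^+ 4)) -mulr_sumr sumrB -mulr_sumr.
have -> : \sum_(i < n) eta * (i == i)%:R = eta * n%:R.
  under eq_bigr do rewrite eqxx mulr1.
  by rewrite sumr_const card_ord mulr_natr.
rewrite /laplacian.
by move: (\sum_i _) => q; field.
Unshelve. all: end_near. Qed.

(** Compactness of [psi >= eps] makes the threshold on [h] uniform in [z];
elsewhere the truncation vanishes and the bound is trivial. *)
Lemma heat_truncation_step eps rho : 0 < eps -> 0 < rho ->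
  exists2 h0, 0 < h0 & forall h, 0 < h < h0 -> forall z,
    expR (- (m * rho ^+ 2 * h)) * truncation eps rho z - (m * rho ^+ 2 + 1) * eps * h <=
    heat_semigroup h (truncation eps rho) z.
Proof.
move=> eps0 rho0.
pose P (h : R) y := forall z, rho *: z = y ->
    expR (- (m * rho ^+ 2 * h)) * truncation eps rho z - (m * rho ^+ 2 + 1) * eps * h <=
    heat_semigroup h (truncation eps rho) z.
have /compact_near_coveringP cov := psi_compact eps0.
have := cov R 0^'+ P _ (fun x xK => heat_truncation_one_step eps0 rho0 xK).
move=> [h0 /= h00 hP]; exists h0 => // h /andP[hp hh] z.
have [zeps|zeps] := ltP (psi (rho *: z)) eps.
  have /andP[F0 _] := heat_semigroup_bounds z hp (bounded_truncation rho (ltW eps0)).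
  rewrite {1}/truncation max_r; last by rewrite subr_le0 ltW.
  rewrite mulr0 sub0r (le_trans _ F0)// oppr_le0 !mulr_ge0 ?(ltW eps0) ?(ltW hp)//.
  by rewrite addr_ge0// mulr_ge0// sqr_ge0.
apply: (hP h _ hp (rho *: z)) => //=.
by rewrite sub0r normrN gtr0_norm.
Qed.

(** Time [t] is cut into equal steps below the threshold. Applying the
semigroup to a one-step bound does not amplify its error, since the kernel has
mass 1, so the errors add up to [O(eps t)]. *)
Lemma heat_truncation_iter eps rho t z : 0 < eps -> 0 < rho -> 0 < t ->
  expR (- (m * rho ^+ 2 * t)) * truncation eps rho z - (m * rho ^+ 2 + 1) * eps * t <=
  heat_semigroup t (truncation eps rho) z.
Proof.
move=> eps0 rho0 t0; have [h0 h00 step] := heat_truncation_step eps0 rho0.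
have bF := bounded_truncation rho (ltW eps0).
pose c := m * rho ^+ 2.
have c0 : 0 <= c by rewrite mulr_ge0// sqr_ge0.
have iter h (N : nat) : 0 < h < h0 -> forall z,
    expR (- (c * (N.+1%:R * h))) * truncation eps rho z - (c + 1) * eps * (N.+1%:R * h) <=
    heat_semigroup (N.+1%:R * h) (truncation eps rho) z.
  move=> hh; have /andP[hp _] := hh; elim: N => [|N ih] {}z; first by rewrite mul1r; exact: step.
  have Nh0 : 0 < N.+1%:R * h by rewrite mulr_gt0.
  rewrite -[N.+2]add1n natrD mulrDl mul1r (heat_semigroupD z hp Nh0 bF).
  set E := expR (- (c * (N.+1%:R * h))); set K := (c + 1) * eps * (N.+1%:R * h).
  have H := isintB (isintZ E (isint_heat_semigroup_ge0 z hp bF)) (isintZ K (isint_heat_kernel z hp)).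
  apply: (@le_trans _ _ (E * heat_semigroup h (truncation eps rho) z - K * 1)).
    rewrite mulr1 mulrDr opprD expRD -mulrA mulrCA -/E mulrDr opprD addrA -/K lerB//.
    have := ler_wpM2l (expR_ge0 _ : 0 <= E) (step h hh z).
    have E1 : E <= 1 by rewrite -[leRHS]expR0 ler_expR oppr_le0 mulr_ge0// ltW.
    apply: le_trans; rewrite mulrBr lerB// ler_piMl// mulr_ge0 ?(ltW hp)//.
    by rewrite mulr_ge0 ?(ltW eps0)// addr_ge0.
  apply: isint_le H (isint_heat_semigroup_ge0 z hp (bounded_ge0_heat_semigroup Nh0 bF)) _ => y.
  by rewrite mulrCA (mulrC K) -mulrBr ler_wpM2l ?heat_kernel_ge0.
(* t / N.+1 < h0 with N = floor (t / h0). *)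
pose N := Num.truncn (t / h0).
have hN : 0 < t / N.+1%:R < h0.
  rewrite divr_gt0//= ltr_pdivrMr// mulrC -ltr_pdivrMr//; exact: truncnS_gt.
by have := iter _ N hN z; rewrite (mulrC N.+1%:R) divfK.
Qed.

Lemma bounded_scaled rho : bounded_ge0 M (fun x => psi (rho *: x)).
Proof.
have [mT _] := bounded_truncation rho (lexx 0); split => //.
congr (measurable_fun _ _): mT; apply/funext => x; rewrite /truncation subr0 max_l//.
by case/andP: (psiM (rho *: x)).
Qed.

Lemma bounded_scaled_sqr rho : bounded_ge0 (M ^+ 2) (fun x => psi (rho *: x) ^+ 2).
Proof.
have [mp bp] := bounded_scaled rho; split; first exact: measurable_funX.
move=> x; rewrite sqr_ge0/=; have /andP[p0 pM] := bp x.
by rewrite lerXn2r ?nnegrE// (le_trans p0).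
Qed.

(** Let [eps] tend to [0] in the bound for the truncation. *)
Lemma heat_subsolution rho t z : 0 < rho -> 0 < t ->
  expR (- (m * rho ^+ 2 * t)) * psi (rho *: z) <= heat_semigroup t (fun x => psi (rho *: x)) z.
Proof.
move=> rho0 t0.
have b0 := bounded_scaled rho.
pose c := m * rho ^+ 2.
have c0 : 0 <= c by rewrite mulr_ge0// sqr_ge0.
apply/ler_addgt0Pr => e e0.
pose eps := e / (1 + (c + 1) * t).
have d0 : 0 < 1 + (c + 1) * t by rewrite ltr_pwDl// mulr_ge0 ?(ltW t0)// addr_ge0.
have eps0 : 0 < eps by rewrite divr_gt0.
have h1 := heat_truncation_iter z eps0 rho0 t0.
have h2 : heat_semigroup t (truncation eps rho) z <= heat_semigroup t (fun x => psi (rho *: x)) z.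
  apply: (le_heat_semigroup z t0 (bounded_truncation rho (ltW eps0)) b0) => y.
  by rewrite ge_max lerBlDr lerDl (ltW eps0)/=; case/andP: (psiM (rho *: y)).
have h3 : psi (rho *: z) - eps <= truncation eps rho z by rewrite le_max lexx.
have E0 := expR_ge0 (- (c * t)).
have E1 : expR (- (c * t)) <= 1 by rewrite -[leRHS]expR0 ler_expR oppr_le0 mulr_ge0// ltW.
have h4 := ler_wpM2l E0 h3.
have h5 := ler_wpM2r (ltW eps0) E1.
have h6 : eps + (c + 1) * eps * t = e by rewrite /eps; field; rewrite gt_eqF.
move: h1 h2 h4 h5 h6; rewrite /c; clear.
move: (expR _) (heat_semigroup _ _ _) (heat_semigroup _ _ _) (psi _) (truncation _ _ _) => *; lra.
Qed.

(** Jensen's inequality for the square, in the form [v^2 >= 2 c v - c^2] with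
[c] equal to the lower bound of [heat_subsolution] at [z]. *)
Lemma heat_sqr_subsolution rho t z : 0 < rho -> 0 < t ->
  expR (- (2 * m * rho ^+ 2 * t)) * psi (rho *: z) ^+ 2 <=
  heat_semigroup t (fun x => psi (rho *: x) ^+ 2) z.
Proof.
move=> rho0 t0.
have hs := heat_subsolution z rho0 t0.
have mE : 2 * m * rho ^+ 2 * t = 2 * (m * rho ^+ 2 * t) by rewrite !mulrA.
rewrite mE -mulNr mulrC [- 2 * _]mulrC mulrN -mulNr expRM_natr.
set E := expR _ in hs *; set c := E * psi (rho *: z) in hs.
have c0 : 0 <= c by rewrite mulr_ge0 ?expR_ge0//; case/andP: (psiM (rho *: z)).
rewrite mulrC -exprMn -/c.
have H := isintB (isintZ (2 * c) (isint_heat_semigroup_ge0 z t0 (bounded_scaled rho)))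
  (isintZ (c ^+ 2) (isint_heat_kernel z t0)).
apply: (@le_trans _ _ (2 * c * heat_semigroup t (fun x => psi (rho *: x)) z - c ^+ 2 * 1)).
  by have := ler_wpM2l c0 hs; lra.
apply: isint_le H (isint_heat_semigroup_ge0 z t0 (bounded_scaled_sqr rho)) _ => y.
rewrite mulrCA (mulrC (c ^+ 2)) -mulrBr ler_wpM2l ?heat_kernel_ge0//.
by have := sqr_ge0 (psi (rho *: y) - c); lra.
Qed.

End subsolution.

(** * Convexity, Jensen's inequality and duality *)

Section powR_convex.
Variable R : realType.
Implicit Types (p a b M : R).

(** Convexity of the power, obtained from Young's inequality applied to [b] and
[a^(p - 1)] with conjugate exponents [p] and [p / (p - 1)]. *)
Lemma powR_tangent p a b : 1 <= p -> 0 <= a -> 0 <= b ->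
  a `^ p + p * a `^ (p - 1) * (b - a) <= b `^ p.
Proof.
rewrite le_eqVlt => /predU1P[<- a0 b0|p1 a0 b0].
  by rewrite subrr powRr0 !powRr1// !mul1r addrC subrK.
have p0 : 0 < p by lra.
pose q := p / (p - 1).
have q0 : 0 < q by rewrite divr_gt0// subr_gt0.
have pq : p^-1 + q^-1 = 1 by rewrite /q; field; rewrite gt_eqF ?subr_gt0 ?gt_eqF.
have := conjugate_powR b0 (powR_ge0 a (p - 1)) p0 q0 pq.
rewrite -powRrM (_ : (p - 1) * q = p); last by rewrite /q; field; rewrite gt_eqF ?subr_gt0.
have aE : a `^ (p - 1) * a = a `^ p.
  rewrite -{2}(powRr1 a0) -powRD ?subrK//.
  by rewrite gt_eqF.
have aE2 : p * (a `^ (p - 1) * a) = p * a `^ p by rewrite aE.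
move=> h.
have := ler_wpM2l (ltW p0) h.
rewrite (_ : p * (b `^ p / p + a `^ p / q) = b `^ p + (p - 1) * a `^ p); last first.
  by rewrite /q; field; rewrite !gt_eqF ?subr_gt0.
by lra.
Qed.

Lemma powR_lipschitz p M a b : 1 <= p -> 0 <= a <= M -> 0 <= b <= M ->
  `|a `^ p - b `^ p| <= p * M `^ (p - 1) * `|a - b|.
Proof.
have half x y : 1 <= p -> 0 <= x <= M -> 0 <= y <= M ->
    x `^ p - y `^ p <= p * M `^ (p - 1) * `|x - y|.
  move=> p1 /andP[x0 xM] /andP[y0 yM].
  have p0 : 0 <= p by lra.
  have h := powR_tangent p1 x0 y0.
  have h2 : p * x `^ (p - 1) * (x - y) <= p * M `^ (p - 1) * `|x - y|.
    rewrite (@le_trans _ _ (p * x `^ (p - 1) * `|x - y|))//.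
      by rewrite ler_wpM2l ?ler_norm// mulr_ge0// powR_ge0.
    rewrite ler_wpM2r// ler_wpM2l// ge0_ler_powR ?nnegrE ?subr_ge0//.
    exact: le_trans xM.
  by apply: le_trans h2; lra.
move=> p1 aM bM; rewrite ler_norml (half a b)// andbT lerNl opprB distrC.
exact: half.
Qed.

End powR_convex.

Section integral_tools.
Variables (R : realType) (n : nat).
Implicit Types (t M : R) (f g phi v : 'rV[R]_n -> R).
Local Notation mu := (lebesgue_rV R n).

Lemma isint_bounded_mul M f phi : measurable_fun setT f -> (forall x, `|f x| <= M) ->
  mu.-integrable setT (EFin \o phi) ->
  isint mu (fun x => f x * phi x) (\int[mu]_x (f x * phi x)).
Proof.
move=> mf fM iphi; apply: isint_integrable.
have [hi _] := isintZ M (isint_integrable iphi).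
apply: le_integrable hi => //.
  apply/measurable_EFinP; apply: measurable_funM => //; apply/measurable_EFinP.
  exact: measurable_int iphi.
move=> y _ /=; rewrite lee_fin !normrM ler_wpM2r//.
exact: le_trans (fM y) (ler_norm _).
Qed.

Lemma isint_bounded_ge0_mul M f phi : bounded_ge0 M f ->
  mu.-integrable setT (EFin \o phi) ->
  isint mu (fun x => f x * phi x) (\int[mu]_x (f x * phi x)).
Proof.
move=> [mf fM]; apply: (isint_bounded_mul (M := M)) => // x.
by have /andP[f0 fx] := fM x; rewrite ger0_norm.
Qed.

(** Integrate the tangent line inequality at the point [a] against [phi]. An
upper bound [B] on the mass of [phi] suffices because the constant term of the
tangent line, [(1 - p) a^p], is nonpositive. *)
Lemma jensen_powR p M B a phi v : 1 <= p -> bounded_ge0 M v -> 0 <= a ->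
  (forall x, 0 <= phi x) -> mu.-integrable setT (EFin \o phi) ->
  \int[mu]_x phi x <= B -> B * a <= \int[mu]_x (v x * phi x) ->
  B * a `^ p <= \int[mu]_x (v x `^ p * phi x).
Proof.
move=> p1 bv a0 phi0 iphi phiB va; have p0 : 0 <= p by lra.
have bvp : bounded_ge0 (M `^ p) (fun x => v x `^ p).
  have [mv vM] := bv; split; first exact: (measurableT_comp (measurable_powR _) mv).
  move=> x; have /andP[v0 vx] := vM x; rewrite powR_ge0/= ge0_ler_powR// nnegrE//.
  exact: le_trans vx.
have H := isintD (isintZ (p * a `^ (p - 1)) (isint_bounded_ge0_mul bv iphi))
  (isintZ (a `^ p - p * a `^ (p - 1) * a) (isint_integrable iphi)).
apply: (@le_trans _ _ (p * a `^ (p - 1) * \int[mu]_x (v x * phi x) +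
    (a `^ p - p * a `^ (p - 1) * a) * \int[mu]_x phi x)); last first.
  apply: isint_le H (isint_bounded_ge0_mul bvp iphi) _ => x.
  rewrite mulrA -mulrDl ler_wpM2r//.
  have [_ /(_ x)/andP[vx0 _]] := bv.
  by have := powR_tangent p1 a0 vx0; lra.
have c0 : 0 <= p * a `^ (p - 1) by rewrite mulr_ge0// powR_ge0.
have aE : a `^ p <= a `^ (p - 1) * a.
  have [->|an0] := eqVneq a 0; first by rewrite powR0 ?mulr0// gt_eqF//; lra.
  rewrite -{3}(powRr1 a0) -powRD ?subrK//.
  by rewrite an0 implybT.
have d0 : a `^ p - p * a `^ (p - 1) * a <= 0.
  by rewrite subr_le0 -mulrA (le_trans aE)// ler_peMl// mulr_ge0// powR_ge0.
have h1 := ler_wpM2l c0 va; have h2 := ler_wnM2l d0 phiB.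
by move: h1 h2; set X := \int[mu]_x _; set Y := \int[mu]_x _; lra.
Qed.

(** Tonelli and the symmetry of the kernel. *)
Lemma heat_semigroup_adjoint t M M' f phi : 0 < t -> bounded_ge0 M f -> bounded_ge0 M' phi ->
  (\int[mu]_x (phi x * heat_semigroup t f x)%:E =
   \int[mu]_x (f x * heat_semigroup t phi x)%:E)%E.
Proof.
move=> t0 bf bphi; have [mf fM] := bf; have [mphi phiM] := bphi.
have f0 x : 0 <= f x by case/andP: (fM x).
have phi0 x : 0 <= phi x by case/andP: (phiM x).
pose F (z : 'rV[R]_n * 'rV[R]_n) := (phi z.1 * (heat_kernel t (z.1 - z.2) * f z.2))%:E.
have mF : measurable_fun setT F.
  apply/measurable_EFinP; apply: measurable_funM; first exact: (measurableT_comp mphi measurable_fst).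
  apply: measurable_funM; first exact: measurable_heat_kernel_sub.
  exact: (measurableT_comp mf measurable_snd).
have F0 (z : 'rV[R]_n * 'rV[R]_n) : (0 <= F z)%E.
  by rewrite /F lee_fin mulr_ge0// mulr_ge0// heat_kernel_ge0.
have := fubini_tonelli (m1 := mu) (m2 := mu) F mF F0; rewrite /F /= => E.
transitivity (\int[mu]_x \int[mu]_y (phi x * (heat_kernel t (x - y) * f y))%:E)%E.
  apply: eq_integral => x _.
  by have [_ <-] := isintZ (phi x) (isint_heat_semigroup_ge0 x t0 bf).
rewrite E; apply: eq_integral => y _.
have [_ <-] := isintZ (f y) (isint_heat_semigroup_ge0 y t0 bphi).
by apply: eq_integral => x _; rewrite heat_kernelC; congr EFin; ring.
Qed.

Lemma ae_eq_heat_semigroup t f g x : measurable_fun setT f -> measurable_fun setT g ->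
  {ae mu, forall y, f y = g y} -> heat_semigroup t f x = heat_semigroup t g x.
Proof.
move=> mf mg fg; rewrite /heat_semigroup /Rintegral; congr fine.
apply: ae_eq_integral => //.
- apply/measurable_EFinP; apply: measurable_funM => //; exact: measurable_heat_kernel_subl.
- apply/measurable_EFinP; apply: measurable_funM => //; exact: measurable_heat_kernel_subl.
- by apply: filterS fg => y -> .
Qed.

End integral_tools.

(** * Measurability in time and space *)

Section floor_sections.
Context d (X : measurableType d) (R : realType).

(** Countably many measurable pieces, one for each value of the floor. *)
Lemma measurable_floor_section (F : int -> X -> R) N :
  (forall k, measurable_fun setT (F k)) ->
  measurable_fun setT
    (fun z : measurableTypeR R * X => F (Num.floor (z.1 * N.+1%:R)) z.2).
Proof.
move=> mF _ Y mY; rewrite setTI.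
pose A (k : int) : set (measurableTypeR R) := `[k%:~R / N.+1%:R, (k + 1)%:~R / N.+1%:R[%classic.
rewrite [X in measurable X](_ : _ = \bigcup_k (A k `*` (F k @^-1` Y))).
  apply: countable_bigcupT_measurable; first exact: countableP.
  move=> k; apply: measurableX; first exact: measurable_itv.
  by rewrite -[X in measurable X]setTI; exact: mF.
have AE k a : A k a <-> Num.floor (a * N.+1%:R) = k.
  rewrite /A /= in_itv/= ler_pdivrMr// ltr_pdivlMr//; split.
    by move=> h; exact: floor_def.
  by move=> <-; exact: floor_itv.
apply/seteqP; split => [[a x] /= Yax|[a x] [k _ [/= /AE <-]]//].
by exists (Num.floor (a * N.+1%:R)) => //; split => //=; apply/AE.
Qed.

(** A function that is measurable in [x] and continuous in [s] on an interval
is the limit of its samples on a grid of times, hence jointly measurable. *)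
Lemma measurable_continuous_sections (a b : R) (G : R -> X -> R) :
  (forall s, a < s < b -> measurable_fun setT (G s)) ->
  (forall x s, a < s < b -> {for s, continuous (G^~ x)}) ->
  measurable_fun setT (fun z : measurableTypeR R * X =>
    if a < z.1 < b then G z.1 z.2 else 0).
Proof.
move=> mG cG.
pose H s x := if a < s < b then G s x else 0.
pose h (N : nat) (z : measurableTypeR R * X) :=
  \1_(`]a, b[%classic) z.1 * H ((Num.floor (z.1 * N.+1%:R))%:~R / N.+1%:R) z.2.
apply: (@measurable_fun_cvg _ _ _ setT h) => //.
  move=> N; apply: measurable_funM.
    apply: (measurableT_comp _ measurable_fst); apply: measurable_indic; exact: measurable_itv.
  apply: (@measurable_floor_section (fun k => H (k%:~R / N.+1%:R))) => k.
  have [kab|kab] := boolP (a < k%:~R / N.+1%:R < b).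
    rewrite (_ : H _ = G (k%:~R / N.+1%:R)); first exact: mG.
    by apply/funext => x; rewrite /H kab.
  rewrite (_ : H _ = cst 0); first exact: measurable_cst.
  by apply/funext => x; rewrite /H (negbTE kab).
move=> [s x] _; rewrite /h /=.
have [sab|sab] := boolP (a < s < b); last first.
  apply: cvg_near_cst; apply: nearW => N.
  by rewrite indicE memNset ?mul0r//= in_itv/=; exact/negP.
have cs : (Num.floor (s * N.+1%:R))%:~R / N.+1%:R @[N --> \oo] --> s.
  apply/cvgrPdist_le => e e0; have /cvgrPdist_le/(_ e e0) := @cvg_harmonic R.
  apply: filterS => N /=; rewrite sub0r normrN ger0_norm ?invr_ge0//.
  exact/le_trans/floor_grid_close.
have cG' := @cvg_comp _ _ _ _ (G^~ x) _ _ _ cs (cG x s sab).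
apply: cvg_trans cG'; apply: near_eq_cvg.
have /cvgrPdist_lt/(_ (Num.min (s - a) (b - s))) := cs.
have [as_ sb] := andP sab.
rewrite lt_min !subr_gt0 as_ sb => /(_ isT).
apply: filterS => N /=; rewrite lt_min ltr_norml ltr_norml => /andP[/andP[_ h2] /andP[h3 _]].
rewrite (_ : \1_`]a, b[ s = 1); last by rewrite indicE mem_set//= in_itv.
by move: h2 h3; rewrite opprB !ltrD2l !ltrN2 mul1r /H => -> ->.
Qed.

End floor_sections.

Section heat_time_continuity.
Variables (R : realType) (n : nat).
Local Notation mu := (lebesgue_rV R n).

(** Dominated convergence, the kernels of times in [(t/2, 2t)] being bounded by
a multiple of the kernel of time [2 t]. *)
Lemma continuous_heat_semigroup_time M (f : 'rV[R]_n -> R) (x : 'rV[R]_n) (t : R) :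
  0 < t -> bounded_ge0 M f ->
  {for t, continuous (fun t => heat_semigroup t f x)}.
Proof.
move=> t0 bf.
have tI : t \in `]t / 2, (2 * t)[%classic by rewrite inE/= in_itv/=; lra.
pose C := (4 * pi * (t / 2)) `^ (- (n%:R / 2)) / (4 * pi * (2 * t)) `^ (- (n%:R / 2)).
have C0 : 0 <= C by rewrite divr_ge0 ?powR_ge0.
have [mf fM] := bf.
have t20 : 0 < 2 * t by rewrite mulr_gt0.
apply: (@continuity_under_integral R _ _ mu
  (fun t y => heat_kernel t (x - y) * f y) setT measurableT (t / 2) (2 * t) _ _
  (fun y => C * (heat_kernel (2 * t) (x - y) * f y))) => //.
- move=> s; rewrite /= in_itv/= => /andP[ts _]; have s0 : 0 < s by lra.
  exact: (isint_heat_semigroup_ge0 x s0 bf).1.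
- apply: nearW => y _ s; rewrite inE/= in_itv/= => /andP[ts _]; have s0 : 0 < s by lra.
  by apply: cvgM; [exact: continuous_heat_kernel_time|exact: cvg_cst].
- exact: (isintZ C (isint_heat_semigroup_ge0 x t20 bf)).1.
- move=> s; rewrite /= in_itv/= => /andP[ts s2]; have s0 : 0 < s by lra.
  apply: nearW => y _; have /andP[f0 _] := fM y.
  rewrite normrM (ger0_norm f0) mulrA ler_wpM2r// ger0_norm ?heat_kernel_ge0//.
  by apply: heat_kernel_le_later; lra.
Qed.

End heat_time_continuity.

(** * The Duhamel term *)

Lemma dist_le_half (R : realType) (A B C l e : R) : C <= B + l -> B <= C + l ->
  l <= e / 2 -> `|A - B| <= e / 2 -> `|A - C| <= e.
Proof. by rewrite !ler_norml; lra. Qed.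

Section duhamel.
Variables (R : realType) (n : nat) (w : R -> 'rV[R]_n -> R) (q M S : R).
Hypotheses (q1 : 1 <= q) (M0 : 0 <= M).
Local Notation mu := (lebesgue_rV R n).
Local Notation leb := (@lebesgue_measure R).
Hypothesis mw : forall s : R, 0 <= s <= S -> measurable_fun setT (w s).
Hypothesis wM : forall s : R, 0 <= s <= S -> {ae mu, forall y, `|w s y| <= M}.
Hypothesis cw : forall s e : R, 0 <= s <= S -> 0 < e ->
  \forall s' \near s, 0 <= s' <= S -> {ae mu, forall y, `|w s y - w s' y| <= e}.
Implicit Types (s t tau e : R) (x y : 'rV[R]_n) (phi : 'rV[R]_n -> R).

(** A representative of [|w s|] that is bounded everywhere, instead of almost
everywhere. *)
Definition clip s y : R := Num.min `|w s y| M.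

Definition source s y : R := clip s y `^ q.

Lemma bounded_clip s : 0 <= s <= S -> bounded_ge0 M (clip s).
Proof.
move=> sS; split => [|y].
  by apply: measurable_minr => //; apply: measurableT_comp => //; exact: mw.
by rewrite le_min normr_ge0 M0/= ge_min lexx orbT.
Qed.

Lemma bounded_source s : 0 <= s <= S -> bounded_ge0 (M `^ q) (source s).
Proof.
move=> sS; have [mc cM] := bounded_clip sS; split.
  exact: (measurableT_comp (measurable_powR _) mc).
move=> y; have /andP[c0 cy] := cM y.
rewrite /source powR_ge0/=; apply: ge0_ler_powR; rewrite ?nnegrE//; exact: le_trans ler01 q1.
Qed.

Lemma measurable_norm_powR s : 0 <= s <= S -> measurable_fun setT (fun y => `|w s y| `^ q).
Proof.
move=> sS; apply: (measurableT_comp (measurable_powR _)).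
by apply: measurableT_comp => //; exact: mw.
Qed.

Lemma clip_ae s : 0 <= s <= S -> {ae mu, forall y, clip s y = `|w s y|}.
Proof.
by move=> /wM; apply: filterS => y wy; rewrite /clip min_l.
Qed.

Lemma heat_source tau s x : 0 <= s <= S ->
  heat_semigroup tau (fun y => `|w s y| `^ q) x = heat_semigroup tau (source s) x.
Proof.
move=> sS; apply: ae_eq_heat_semigroup.
- exact: measurable_norm_powR.
- by have [] := bounded_source sS.
- by apply: filterS (clip_ae sS) => y; rewrite /source => ->.
Qed.

Let lipq := q * M `^ (q - 1).

Lemma lipq_ge0 : 0 <= lipq.
Proof. by rewrite mulr_ge0 ?powR_ge0// (le_trans ler01 q1). Qed.

(** The power is Lipschitz between [0] and [M] and the kernel has mass 1. *)
Lemma heat_source_le tau e s s' x : 0 < tau -> 0 <= s <= S -> 0 <= s' <= S -> 0 <= e ->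
  {ae mu, forall y, `|w s y - w s' y| <= e} ->
  heat_semigroup tau (source s') x <= heat_semigroup tau (source s) x + lipq * e.
Proof.
move=> tau0 sS s'S e0 ww.
have [ms sM] := bounded_source sS; have [ms' s'M] := bounded_source s'S.
(* The comparison holds only almost everywhere; g is a version of source s'
   for which it holds everywhere. *)
pose g y := Num.min (source s' y) (source s y + lipq * e).
have mg : measurable_fun setT g.
  by apply: measurable_minr => //; exact: measurable_funD.
have bg : bounded_ge0 (M `^ q) g.
  split => // y; have /andP[a0 aM] := s'M y; have /andP[b0 bM] := sM y.
  have le0 : 0 <= lipq * e := mulr_ge0 lipq_ge0 e0.
  by apply/andP; split; [rewrite le_min a0 addr_ge0|rewrite ge_min aM].
have -> : heat_semigroup tau (source s') x = heat_semigroup tau g x.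
  apply: ae_eq_heat_semigroup => //.
  apply: filterS ww => y wy; rewrite /g min_l//.
  have [_ cM] := bounded_clip sS; have [_ c'M] := bounded_clip s'S.
  have h : `|source s' y - source s y| <= lipq * `|clip s' y - clip s y|.
    exact: powR_lipschitz.
  have h2 : `|clip s' y - clip s y| <= e.
    rewrite /clip (le_trans _ wy)// (le_trans _ (ler_dist_dist _ _))// distrC.
    move: `|w s y| `|w s' y| => a b; rewrite !minElt.
    by case: ifPn => ?; case: ifPn => ?; rewrite ?subrr ?normr0//; 
      rewrite !ler_norml; have := ler_norm (a - b); have := ler_norm (b - a); rewrite (distrC b a); lra.
  have := ler_wpM2l lipq_ge0 h2; have := ler_norm (source s' y - source s y).
  by move: h; lra.
have H := isintD (isint_heat_semigroup_ge0 x tau0 (bounded_source sS))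
  (isintZ (lipq * e) (isint_heat_kernel x tau0)).
rewrite -[lipq * e]mulr1.
apply: isint_le (isint_heat_semigroup_ge0 x tau0 bg) H _ => y.
by rewrite (mulrC (lipq * e)) -mulrDr ler_wpM2l ?heat_kernel_ge0// ge_min lexx orbT.
Qed.

(** Two contributions: the smoothing time [t - s], by continuity of the
semigroup in time, and the source at time [s], by continuity of [w] in
L^infinity. *)
Lemma continuous_duhamel_integrand t x s : t <= S -> 0 < s < t ->
  {for s, continuous (fun s => heat_semigroup (t - s) (source s) x)}.
Proof.
move=> tS st; have [s0 s_t] := andP st.
have sS : 0 <= s <= S by lra.
have c2 : (fun s' => heat_semigroup (t - s') (source s) x) @ s --> heat_semigroup (t - s) (source s) x.
  apply: (@continuous_comp _ _ _ (fun s' : R => t - s') (fun tau => heat_semigroup tau (source s) x)).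
    by apply: cvgB; [exact: cvg_cst|exact: cvg_id].
  by have ts0 : 0 < t - s; [lra|exact: (@continuous_heat_semigroup_time _ _ _ _ x _ ts0 (bounded_source sS))].
apply/cvgrPdist_le => e e0.
have e20 : 0 < e / 2 by lra.
have L0 := lipq_ge0.
pose d := e / 2 / (lipq + 1).
have d0 : 0 < d by rewrite divr_gt0// ltr_wpDl.
have dE : lipq * d <= e / 2.
  rewrite /d mulrCA ler_piMr ?(ltW e20)// ler_pdivrMr ?ltr_wpDl// mul1r.
  by rewrite lerDl.
have /cvgrPdist_le/(_ _ e20) n1 := c2.
have n2 := cw sS d0.
have n3 : \forall s' \near s, 0 < s' by exact: lt_nbhsr.
have n4 : \forall s' \near s, s' < t by exact: lt_nbhsl.
near=> s'.
have s'0 : 0 < s' by near: s'.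
have s't : s' < t by near: s'.
have s'S : 0 <= s' <= S by lra.
have ww : {ae mu, forall y, `|w s y - w s' y| <= d}.
  have : 0 <= s' <= S -> {ae mu, forall y, `|w s y - w s' y| <= d} by near: s'.
  exact.
have ww' : {ae mu, forall y, `|w s' y - w s y| <= d}.
  by apply: filterS ww => y; rewrite distrC.
have ts'0 : 0 < t - s' by lra.
have h1 := heat_source_le x ts'0 sS s'S (ltW d0) ww.
have h2 := heat_source_le x ts'0 s'S sS (ltW d0) ww'.
apply: (dist_le_half h1 h2 dE).
by near: s'.
Unshelve. all: end_near. Qed.

(** Extended by [0] outside [0 < s < t] so that the space-time integrand is
measurable on the whole product. *)
Definition duhamel_integrand t s x : R :=
  if 0 < s < t then heat_semigroup (t - s) (source s) x else 0.

Lemma measurable_duhamel_integrand t : t <= S -> measurable_fun setT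
  (fun z : measurableTypeR R * 'rV[R]_n => duhamel_integrand t z.1 z.2).
Proof.
move=> tS; apply: (@measurable_continuous_sections _ _ _ 0 t
  (fun s x => heat_semigroup (t - s) (source s) x)).
- move=> s /andP[s0 s_t]; have sS : 0 <= s <= S by lra.
  have ts0 : 0 < t - s by lra.
  exact: (measurable_heat_semigroup ts0 (bounded_source sS)).
- by move=> x s st; exact: continuous_duhamel_integrand.
Qed.

Lemma duhamel_integrand_bounds t s x : t <= S -> 0 <= duhamel_integrand t s x <= M `^ q.
Proof.
move=> tS; rewrite /duhamel_integrand; case: ifPn => [/andP[s0 s_t]|_].
  have sS : 0 <= s <= S by lra.
  by apply: heat_semigroup_bounds; [lra|exact: bounded_source].
by rewrite lexx powR_ge0.
Qed.

(** Rewrites the time integral of Duhamel's formula as that of a bounded,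
jointly measurable function, to which Tonelli's theorem applies. *)
Lemma isint_duhamel t x : 0 <= t <= S ->
  isint leb (fun s => duhamel_integrand t s x)
    (\int[leb]_(s in `]0, t[) heat_semigroup (t - s) (fun y => `|w s y| `^ q) x).
Proof.
move=> /andP[t0 tS].
have mG : measurable_fun setT (fun s => duhamel_integrand t s x).
  exact: (measurableT_comp (measurable_duhamel_integrand tS) (measurable_pair2 x)).
have iG : leb.-integrable setT (EFin \o (fun s => duhamel_integrand t s x)).
  have [hi _] := isintZ (M `^ q) (isint_integrable (integrable_indic_itv 0 t false true)).
  apply: le_integrable hi => //; first exact/measurable_EFinP.
  move=> s _ /=; have /andP[G0 GM] := duhamel_integrand_bounds s x tS.
  rewrite lee_fin (ger0_norm G0) ger0_norm ?mulr_ge0 ?powR_ge0//.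
  rewrite indicE; case: (boolP (0 < s < t)) => [st|st].
    by rewrite mem_set ?mulr1//= in_itv.
  by rewrite /duhamel_integrand (negbTE st) mulr_ge0 ?powR_ge0.
have := isint_integrable iG; congr isint.
rewrite [RHS]Rintegral_mkcond; apply: eq_Rintegral => s _.
rewrite patchE /duhamel_integrand; case: ifPn => [st|st].
  have sS : 0 <= s <= S.
    by move: st => /andP[s0 s_t]; rewrite (ltW s0) (le_trans (ltW s_t) tS).
  have sI : (`]0, t[%classic : set R) s by rewrite /= in_itv.
  by rewrite (mem_set sI) (heat_source _ _ sS).
by rewrite memNset//= in_itv/=; exact/negP.
Qed.

Lemma measurable_duhamel t : 0 <= t <= S -> measurable_fun setT (fun x =>
  \int[leb]_(s in `]0, t[) heat_semigroup (t - s) (fun y => `|w s y| `^ q) x).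
Proof.
move=> tS; have /andP[t0 t_S] := tS; apply/measurable_EFinP.
pose F (z : measurableTypeR R * 'rV[R]_n) := (duhamel_integrand t z.1 z.2)%:E.
have mF : measurable_fun setT F by apply/measurable_EFinP; exact: measurable_duhamel_integrand.
have F0 (z : measurableTypeR R * 'rV[R]_n) : (0 <= F z)%E.
  by rewrite /F lee_fin; case/andP: (duhamel_integrand_bounds z.1 z.2 t_S).
have := measurable_fun_fubini_tonelli_G (m1 := leb) F mF F0.
congr measurable_fun; apply/funext => x /=; rewrite /fubini_G.
exact: (isint_duhamel x tS).2.
Qed.

(** Tonelli exchanges the time integral with the pairing by [phi]; the times
before [t0] contribute a nonnegative amount. *)
Lemma duhamel_pairing_ge phi Mphi t t0 L : bounded_ge0 Mphi phi -> 0 <= t0 <= t -> t <= S ->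
  0 <= L ->
  (forall s, t0 <= s < t -> (L%:E <= \int[mu]_x (phi x * heat_semigroup (t - s) (source s) x)%:E)%E) ->
  (((t - t0) * L)%:E <= \int[mu]_x (phi x *
    \int[leb]_(s in `]0%R, t[) heat_semigroup (t - s) (fun y => `|w s y| `^ q) x)%:E)%E.
Proof.
move=> [mphi phiM] /andP[t00 t0t] tS L0 hL.
have phi0 x : 0 <= phi x by case/andP: (phiM x).
pose F (z : measurableTypeR R * 'rV[R]_n) := (phi z.2 * duhamel_integrand t z.1 z.2)%:E.
have mF : measurable_fun setT F.
  apply/measurable_EFinP; apply: measurable_funM; first exact: (measurableT_comp mphi measurable_snd).
  exact: measurable_duhamel_integrand.
have F0 (z : measurableTypeR R * 'rV[R]_n) : (0 <= F z)%E.
  by rewrite /F lee_fin mulr_ge0//; case/andP: (duhamel_integrand_bounds z.1 z.2 tS).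
have := fubini_tonelli (m1 := leb) (m2 := mu) F mF F0; rewrite /F /= => E.
rewrite [leRHS](_ : _ = \int[mu]_x \int[leb]_s (phi x * duhamel_integrand t s x)%:E)%E; last first.
  apply: eq_integral => x _.
  by have [|_ <-] := isintZ (phi x) (@isint_duhamel t x _); first by rewrite tS andbT (le_trans t00).
rewrite -E.
have -> : (((t - t0) * L)%:E = \int[leb]_(s in `]t0, t[) (cst L%:E) s)%E.
  rewrite integral_cst//= lebesgue_measure_itv/= lte_fin.
  have [tt|tt] := ltP t0 t; first by rewrite -EFinB -EFinM mulrC.
  have -> : t0 = t by apply/eqP; rewrite eq_le t0t.
  by rewrite subrr mul0r mule0.
rewrite integral_mkcond; apply: ge0_le_integral => //.
- by move=> s _; rewrite patchE; case: ifP => // _; rewrite lee_fin.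
- by apply/(measurable_restrictT _ _).1; [exact: measurable_itv|exact: measurable_cst].
- have := measurable_fun_fubini_tonelli_F (m2 := mu) F mF F0.
  exact.
move=> s _; rewrite patchE; case: ifPn => [|_]; last first.
  by apply: integral_ge0 => x _; exact: (F0 (s, x)).
rewrite inE/= in_itv/= => /andP[ts st].
have st' : 0 < s < t by rewrite st (le_lt_trans t00 ts).
apply: le_trans (hL s _) _; first by rewrite (ltW ts).
rewrite le_eqVlt; apply/orP; left; apply/eqP; apply: eq_integral => x _.
by rewrite /duhamel_integrand st'.
Qed.

End duhamel.

(** * The test function *)

Section eigenfunction.
Variables (R : realType) (n : nat) (lambda : R) (psi : 'rV[R]_n -> R).
Hypotheses (lambda0 : 0 < lambda) (hpsi : is_ball_eigenfunction lambda psi).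
Local Notation mu := (lebesgue_rV R n).
Implicit Types (x z : 'rV[R]_n) (r t M : R).

Lemma coord_le_enorm x i : `|x ord0 i| <= enorm x.
Proof.
rewrite -sqrtr_sqr /enorm ler_sqrt; last by rewrite sumr_ge0// => j _; exact: sqr_ge0.
by rewrite (bigD1 i)//= lerDl sumr_ge0// => j _; exact: sqr_ge0.
Qed.

Lemma eigen_support x : 0 < psi x -> enorm x < 1.
Proof.
by move=> px; rewrite ltNge; apply/negP => /(ball_eigen_out hpsi) px0; rewrite px0 ltxx in px.
Qed.

(** A level set of positive height is closed by continuity and contained in
the unit ball. *)
Lemma eigen_compact eps : 0 < eps -> compact [set x | eps <= psi x].
Proof.
move=> eps0; apply: bounded_closed_compact.
  exists 1; split; first exact: num_real.
  move=> M M1 x /= xeps; rewrite (le_trans _ (ltW M1))//.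
  rewrite [leLHS]mx_normrE; apply/bigmax_leP; split => //= -[i j] _ /=.
  rewrite (ord1 i) (le_trans (coord_le_enorm x j))// ltW// eigen_support//.
  exact: lt_le_trans xeps.
have -> : [set x | eps <= psi x] = psi @^-1` [set y | eps <= y] by [].
apply: closed_comp; last exact: closed_ge.
by move=> x _; exact: (ball_eigen_continuous hpsi).
Qed.

Lemma eigen_bounded : exists2 M, 0 < M & forall x, 0 <= psi x <= M.
Proof.
have cK := eigen_compact ltr01.
have /compact_bounded : compact (psi @` [set x | 1 <= psi x]).
  apply: continuous_compact cK; apply: continuous_subspaceT.
  exact: (ball_eigen_continuous hpsi).
move=> [M0 [_ hM]]; exists (Num.max 1 (M0 + 1)); first by rewrite lt_max ltr01.
move=> x; rewrite (ball_eigen_ge0 hpsi)/= le_max; apply/orP.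
have [px|px] := leP (psi x) 1; [by left|right].
rewrite (le_trans (ler_norm _))//; apply: (hM (M0 + 1)); first by rewrite ltrDl.
by exists x => //=; exact: ltW.
Qed.

Lemma bounded_phi M r : (forall x, 0 <= psi x <= M) -> bounded_ge0 (M ^+ 2) (phi psi r).
Proof.
move=> psiM; exact: (bounded_scaled_sqr psiM (ball_eigen_continuous hpsi)).
Qed.

(** The eigenfunction equation holds where [psi > 0], and squaring turns the
eigenvalue [lambda / 2] into the rate [lambda], divided by [r^2] by scaling. *)
Lemma heat_phi_ge r t z : 0 < r -> 0 < t ->
  expR (- (lambda / r ^+ 2 * t)) * phi psi r z <= heat_semigroup t (phi psi r) z.
Proof.
move=> r0 t0; have [M M0 psiM] := eigen_bounded.
have l20 : 0 <= lambda / 2 by rewrite divr_ge0// ltW.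
have rV0 : 0 < r^-1 by rewrite invr_gt0.
have sub x : 0 < psi x -> - laplacian psi x <= lambda / 2 * psi x.
  by move=> /eigen_support /(ball_eigen_eq hpsi) ->.
have C2 x : 0 < psi x -> [/\ differentiable psi x,
      forall i, differentiable (partial i psi) x &
      forall i j, {for x, continuous (partial j (partial i psi))}].
  by move=> /eigen_support px; exact: (ball_eigen_C2 hpsi).
have := @heat_sqr_subsolution R n psi (lambda / 2) M l20 psiM (ball_eigen_continuous hpsi)
  C2 sub eigen_compact r^-1 t z rV0 t0.
by rewrite exprVn [2 * _]mulrC divfK.
Qed.

(** The support of [phi_r] lies in the cube of half-side [r]. *)
Lemma isint_phi_le M r : (forall x, 0 <= psi x <= M) -> 0 < r ->
  exists2 v, isint mu (phi psi r) v & v <= M ^+ 2 * (2 * r) ^+ n.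
Proof.
move=> psiM r0.
have H : isint mu (fun x => M ^+ 2 * \prod_i \1_(`[- r, r]%classic) (x ord0 i)) (M ^+ 2 * \prod_(i < n) (2 * r)).
  have Hi (i : 'I_n) : isint (@lebesgue_measure R) (\1_(`[- r, r]%classic) : R -> R) (2 * r).
    have hi := integrable_indic_itv (- r) r true false.
    split => //; rewrite integral_indic//= setIT lebesgue_measure_itv/= lte_fin gtrN//.
    by rewrite -EFinD opprK -mulr2n mulr_natl.
  exact: (isintZ (M ^+ 2) (isint_prod_coord Hi)).
have le x : phi psi r x <= M ^+ 2 * \prod_i \1_(`[- r, r]%classic) (x ord0 i).
  have /andP[p0 pM] := (bounded_phi r psiM).2 x.
  have [allx|/existsNP[i /negP xi]] := pselect (forall i, - r <= x ord0 i <= r).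
    by rewrite big1 ?mulr1// => i _; rewrite indicE mem_set//= in_itv/=.
  rewrite /phi (ball_eigen_out hpsi).
    by rewrite expr0n/= mulr_ge0 ?sqr_ge0// prodr_ge0.
  rewrite (le_trans _ (coord_le_enorm _ i))// mxE normrM gtr0_norm ?invr_gt0//.
  rewrite mulrC ler_pdivlMr// mul1r ltW//.
  by rewrite ltNge; apply: contra xi; rewrite ler_norml.
have [mphi _] := bounded_phi r psiM.
have ip : mu.-integrable setT (EFin \o phi psi r).
  apply: le_integrable H.1 => //; first exact/measurable_EFinP.
  move=> x _ /=; have /andP[p0 _] := (bounded_phi r psiM).2 x.
  by rewrite lee_fin (ger0_norm p0) ger0_norm// (le_trans p0).
exists (\int[mu]_x phi psi r x); first exact: isint_integrable.
rewrite [leRHS](_ : _ = M ^+ 2 * \prod_(i < n) (2 * r)); last by rewrite prodr_const card_ord.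
exact: isint_le (isint_integrable ip) H le.
Qed.

Lemma eigen_gt0 : 0 < psi 0.
Proof.
have e0 : enorm (0 : 'rV[R]_n) < 1.
  by rewrite /enorm big1 ?sqrtr0// => i _; rewrite mxE expr0n.
have := ball_eigen_gt0 hpsi e0.
by rewrite pmulr_rgt0// divr_gt0.
Qed.

End eigenfunction.

(** * Moment inequalities along a solution *)

Section L1_Linfty.
Variables (R : realType) (n : nat).
Local Notation mu := (lebesgue_rV R n).
Implicit Types (f : 'rV[R]_n -> R) (T : \bar R) (u : R -> 'rV[R]_n -> R).

Lemma Lnormy_ae_le f (M : R) : ('N[mu]_(+oo) [EFin \o f] <= M%:E)%E ->
  {ae mu, forall x, `|f x| <= M}.
Proof.
rewrite unlock /Lnorm; case: ifPn => [_ /ess_supP|mu0 _].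
  by apply: filterS => x /=; rewrite lee_fin.
exists setT; split => //.
by apply/eqP; move: mu0; rewrite -leNgt measure_le0.
Qed.

Lemma in_L1_LinftyP f : in_L1_Linfty f ->
  [/\ measurable_fun setT f, mu.-integrable setT (EFin \o f) &
      exists2 M : R, 0 <= M & {ae mu, forall x, `|f x| <= M}].
Proof.
move=> [/Lfun1_integrable fi /sub_Lfun_finLfun]; rewrite inE/= => fy.
split => //; first by apply/measurable_EFinP; exact: measurable_int fi.
have f0 := Lnorm_ge0 mu +oo%E (EFin \o f).
exists (fine ('N[mu]_(+oo) [EFin \o f])%E); first exact: fine_ge0.
by apply: Lnormy_ae_le; rewrite fineK// ge0_fin_numE.
Qed.

Lemma time_intervalP T (S s : R) : (S%:E < T)%E -> 0 <= s <= S -> time_interval T s.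
Proof. by move=> ST /andP[s0 sS]; split => //; rewrite (le_lt_trans _ ST)// lee_fin. Qed.

Lemma L1_Linfty_continuous T u (S s e : R) : in_C_L1_Linfty T u -> (S%:E < T)%E ->
  0 <= s <= S -> 0 < e ->
  \forall s' \near s, 0 <= s' <= S -> {ae mu, forall x, `|u s x - u s' x| <= e}.
Proof.
move=> [_ uC] ST sS e0; have [_ cu] := uC s (time_intervalP ST sS).
have : \forall s' \near within (time_interval T) (nbhs s),
    ('N[mu]_(+oo) [EFin \o (u s' \- u s)%R] < e%:E)%E.
  have e_nbhs : nbhs (0 : \bar R)%E [set x | (x < e%:E)%E].
    exists e => //= x /=; rewrite sub0r normrN lte_fin.
    exact: le_lt_trans (ler_norm _).
  exact: cu e_nbhs.
rewrite near_withinE; apply: filterS => s' h s'S.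
have {}h := h (time_intervalP ST s'S).
have := Lnormy_ae_le (ltW h); apply: filterS => x /=.
by rewrite distrC.
Qed.

(** Continuity gives a bound near each time of the compact interval from [0] to [S],
and finitely many of these neighbourhoods suffice. *)
Lemma L1_Linfty_bounded T u (S : R) : in_C_L1_Linfty T u -> (S%:E < T)%E ->
  exists2 M : R, 0 <= M & forall s : R, 0 <= s <= S -> {ae mu, forall x, `|u s x| <= M}.
Proof.
move=> uC ST.
have /compact_near_coveringP cov := @segment_compact R 0 S.
pose P (M s : R) := 0 <= s <= S -> {ae mu, forall x, `|u s x| <= M}.
have key (s : R) : `[0, S]%classic s -> \forall s' \near s & M \near +oo, P M s'.
  rewrite /= in_itv/= => sS.
  have [_ _ [Ms Ms0 uMs]] := in_L1_LinftyP (uC.1 s (time_intervalP ST sS)).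
  have c := L1_Linfty_continuous uC ST sS ltr01.
  near=> s' M => /= s'S.
  have cs' : 0 <= s' <= S -> {ae mu, forall x, `|u s x - u s' x| <= 1} by near: s'.
  have MM : Ms + 1 <= M by near: M; apply: nbhs_pinfty_ge; exact: num_real.
  apply: filterS2 uMs (cs' s'S) => x h1 h2; apply: le_trans MM.
  rewrite -(subrK (u s x) (u s' x)) (le_trans (ler_normD _ _))// addrC lerD//.
  by rewrite distrC.
have := cov R +oo P _ key; move=> [M0 [_ hM]].
exists (Num.max M0 0 + 1); first by rewrite addr_ge0// le_max lexx orbT.
have MM : M0 < Num.max M0 0 + 1.
  by rewrite (@le_lt_trans _ _ (Num.max M0 0))// ?ltrDl// le_max lexx.
have PM := hM _ MM.
move=> s sS; have sI : (`[0, S]%classic : set R) s by rewrite /= in_itv.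
exact: PM sI sS.
Unshelve. all: end_near. Qed.

End L1_Linfty.

Section moments.
Variables (R : realType) (n k : nat) (lambda : R) (psi : 'rV[R]_n -> R).
Hypotheses (lambda0 : 0 < lambda) (hpsi : is_ball_eigenfunction lambda psi).
Variables (p : 'I_k -> R) (u0 : 'I_k -> 'rV[R]_n -> R) (u : 'I_k -> R -> 'rV[R]_n -> R).
Hypothesis p1 : forall j, 1 <= p j.
Hypothesis u0C : forall j, in_L1_Linfty (u0 j).
Hypothesis u0_ge0 : forall j, {ae lebesgue_rV R n, forall x, 0 <= u0 j x}.
Variables (T : \bar R) (S r : R).
Hypotheses (S0 : 0 < S) (ST : (S%:E < T)%E) (r0 : 0 < r) (Sr : S <= r ^+ 2).
Hypothesis usol : is_solution p u0 T u.
Local Notation mu := (lebesgue_rV R n).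
Local Notation leb := (@lebesgue_measure R).
Local Notation U := (moment psi u).

Let kappa := expR (- lambda).

Lemma decay_ge t : 0 <= t <= S -> kappa <= expR (- (lambda / r ^+ 2 * t)).
Proof.
move=> /andP[t0 tS]; rewrite ler_expR lerN2 mulrAC ler_pdivrMr ?exprn_gt0//.
by rewrite ler_wpM2l ?(ltW lambda0)// (le_trans tS).
Qed.

(** For [t <= r^2] the decay of [phi_r] is at most the fixed factor [kappa]. *)
Lemma heat_phi_kappa t z : 0 < t <= S -> kappa * phi psi r z <= heat_semigroup t (phi psi r) z.
Proof.
move=> /andP[t0 tS]; apply: le_trans (heat_phi_ge lambda0 hpsi z r0 t0).
rewrite ler_wpM2r ?sqr_ge0//; apply: decay_ge; lra.
Qed.

Lemma isint_moment j t : 0 <= t <= S -> isint mu (fun x => phi psi r x * u j t x) (U j r t).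
Proof.
move=> tS; have [M M0 psiM] := eigen_bounded hpsi.
have [mut uti _] := in_L1_LinftyP ((solution_class usol j).1 t (time_intervalP ST tS)).
have := isint_bounded_ge0_mul (bounded_phi hpsi r psiM) uti.
rewrite /moment; congr isint; apply: eq_Rintegral => x _; exact: mulrC.
Qed.

(** The semigroup lemmas ask for bounds that hold everywhere, whereas the datum
satisfies them almost everywhere. *)
Lemma initial_representative j : exists M v, bounded_ge0 M v /\ {ae mu, forall x, u0 j x = v x}.
Proof.
have [mu0 _ [M M0 u0M]] := in_L1_LinftyP (u0C j).
exists M, (fun x => Num.min (Num.max (u0 j x) 0) M); split.
  split; first by apply: measurable_minr => //; exact: measurable_maxr.
  by move=> x; rewrite le_min le_max lexx orbT M0/= ge_min lexx orbT.
apply: filterS2 (u0_ge0 j) u0M => x u0x.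
by rewrite ger0_norm// => uM; rewrite max_l// min_l.
Qed.

(** Both terms of Duhamel's formula are nonnegative, so each of them bounds the
moment from below. *)
Lemma moment_split j t : 0 < t <= S -> exists M v,
  [/\ bounded_ge0 M v, {ae mu, forall x, u0 j x = v x},
      (\int[mu]_x (phi psi r x * heat_semigroup t v x)%:E <= (U j r t)%:E)%E &
      (\int[mu]_x (phi psi r x * \int[leb]_(s in `]0%R, t[)
        heat_semigroup (t - s) (fun y => `|u (ordS j) s y| `^ p j) x)%:E <= (U j r t)%:E)%E].
Proof.
move=> /andP[t0 tS]; have tS' : 0 <= t <= S by rewrite (ltW t0).
have [M [v [bv u0v]]] := initial_representative j.
exists M, v.
have [Mp Mp0 psiM] := eigen_bounded hpsi.
have [mphi phiM] := bounded_phi hpsi r psiM.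
have phi0 x : 0 <= phi psi r x by exact: sqr_ge0.
pose I x := \int[leb]_(s in `]0, t[) heat_semigroup (t - s) (fun y => `|u (ordS j) s y| `^ p j) x.
have I0 x : 0 <= I x.
  apply: Rintegral_ge0 => s _; apply: Rintegral_ge0 => y _.
  by rewrite mulr_ge0 ?heat_kernel_ge0 ?powR_ge0.
have [Mu Mu0 uM] := L1_Linfty_bounded (solution_class usol (ordS j)) ST.
have mu_ s : 0 <= s <= S -> measurable_fun setT (u (ordS j) s).
  by move=> sS; have [] := in_L1_LinftyP ((solution_class usol (ordS j)).1 s (time_intervalP ST sS)).
have cu s e : 0 <= s <= S -> 0 < e -> \forall s' \near s, 0 <= s' <= S ->
    {ae mu, forall x, `|u (ordS j) s x - u (ordS j) s' x| <= e}.
  exact: (L1_Linfty_continuous (solution_class usol (ordS j)) ST).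
have mI : measurable_fun setT I by exact: (measurable_duhamel (p1 j) Mu0 mu_ uM cu tS').
have mh := measurable_heat_semigroup t0 bv.
have h0 x : 0 <= heat_semigroup t v x by case/andP: (heat_semigroup_bounds x t0 bv).
have uE : {ae mu, forall x, u j t x = heat_semigroup t v x + I x}.
  have := solution_duhamel usol j (time_intervalP ST tS') t0.
  apply: filterS => x ->; congr (_ + _).
  apply: ae_eq_heat_semigroup => //; last by case: bv.
  by have [] := in_L1_LinftyP (u0C j).
have UE : ((U j r t)%:E = \int[mu]_x (phi psi r x * (heat_semigroup t v x + I x))%:E)%E.
  have [ip <-] := isint_moment j tS'.
  apply: ae_eq_integral => //.
  - exact: measurable_int ip.
  - by apply/measurable_EFinP; apply: measurable_funM => //; exact: measurable_funD.
  - by apply: filterS uE => x ->.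
have UI : (\int[mu]_x (phi psi r x * I x)%:E <= (U j r t)%:E)%E.
  rewrite UE; apply: ge0_le_integral => //.
  - by move=> x _; rewrite lee_fin mulr_ge0.
  - by apply/measurable_EFinP; exact: measurable_funM.
  - by apply/measurable_EFinP; apply: measurable_funM => //; exact: measurable_funD.
  - by move=> x _; rewrite lee_fin ler_wpM2l// lerDr.
split => //; rewrite UE; apply: ge0_le_integral => //.
- by move=> x _; rewrite lee_fin mulr_ge0.
- by apply/measurable_EFinP; exact: measurable_funM.
- by apply/measurable_EFinP; apply: measurable_funM => //; exact: measurable_funD.
- by move=> x _; rewrite lee_fin ler_wpM2l// lerDl.
Qed.

Lemma moment_initial j M v : bounded_ge0 M v -> {ae mu, forall x, u0 j x = v x} ->
  isint mu (fun x => v x * phi psi r x) (U j r 0).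
Proof.
move=> bv u0v; have S00 : (0 : R) <= 0 <= S by apply/andP; split; [exact: lexx|exact: ltW].
have [hi hU] := isint_moment j S00.
have [Mp Mp0 psiM] := eigen_bounded hpsi.
have [v0 iv vl] := isint_phi_le hpsi psiM r0.
have [vi vU] := isint_bounded_ge0_mul bv iv.1.
split => //; rewrite -hU; apply: ae_eq_integral => //.
- exact: measurable_int vi.
- exact: measurable_int hi.
have T0 : (0%:E < T)%E by apply: le_lt_trans ST; rewrite lee_fin ltW.
have := solution_init usol j T0.
by apply: filterS2 u0v => x <- ->; rewrite mulrC.
Qed.

(** Move the semigroup from the initial datum onto [phi_r]. *)
Lemma moment_ge_initial j t : 0 <= t <= S -> kappa * U j r 0 <= U j r t.
Proof.
move=> /andP[]; rewrite le_eqVlt => /predU1P[<- _|t0 tS].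
  have [M [v [bv u0v]]] := initial_representative j.
  have H := moment_initial bv u0v.
  rewrite ler_piMl//; last by rewrite /kappa -[leRHS]expR0 ler_expR oppr_le0 ltW.
  apply: isint_le (isint0 mu) H _ => x; rewrite mulr_ge0 ?sqr_ge0//.
  by have [_ /(_ x)/andP[]] := bv.
have tS' : 0 < t <= S by rewrite t0.
have [M [v [bv u0v + _]]] := moment_split j tS'.
have [Mp Mp0 psiM] := eigen_bounded hpsi.
have bphi := bounded_phi hpsi r psiM.
rewrite (heat_semigroup_adjoint t0 bv bphi) -lee_fin; apply: le_trans.
have [hi <-] := isintZ kappa (moment_initial bv u0v).
have [mv vM] := bv.
have v0 x : 0 <= v x by case/andP: (vM x).
have k0 : 0 <= kappa := expR_ge0 _.
apply: ge0_le_integral => //.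
- by move=> x _; rewrite lee_fin mulr_ge0// mulr_ge0// sqr_ge0.
- exact: measurable_int hi.
- apply/measurable_EFinP; apply: measurable_funM => //.
  exact: (measurable_heat_semigroup t0 bphi).
- by move=> x _; rewrite lee_fin mulrCA ler_wpM2l// heat_phi_kappa.
Qed.

(** For each time [s], moving the semigroup onto [phi_r] costs the factor
[kappa], and Jensen's inequality bounds the moment of [|u_{j+1}(s)|^p_j] by a
power of the moment of [u_{j+1}(s)]; then integrate in [s] from [t0] to [t]. *)
Lemma moment_ge_source j M t0 t a : (forall x, 0 <= psi x <= M) ->
  0 <= t0 <= t -> t <= S -> 0 <= a ->
  (forall s, t0 <= s < t -> M ^+ 2 * (2 * r) ^+ n * a <= U (ordS j) r s) ->
  (t - t0) * (kappa * (M ^+ 2 * (2 * r) ^+ n * a `^ p j)) <= U j r t.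
Proof.
move=> psiM t0t tS a0 Ua; have /andP[t00 tt] := t0t.
have [tt0|tpos] := leP t 0.
  have tE : t = 0 by apply/eqP; rewrite eq_le tt0 (le_trans t00).
  have t0E : t0 = 0 by apply/eqP; rewrite eq_le t00 andbT (le_trans tt).
  have S00 : (0 : R) <= 0 <= S by apply/andP; split; [exact: lexx|exact: ltW].
  rewrite tE t0E subrr mul0r.
  have [Mv [v [bv u0v]]] := initial_representative j.
  apply: isint_le (isint0 mu) (moment_initial bv u0v) _ => x.
  by rewrite mulr_ge0 ?sqr_ge0//; have [_ /(_ x)/andP[]] := bv.
have tS' : 0 < t <= S by rewrite tpos.
have [_ [_ [_ _ _]]] := moment_split j tS'.
rewrite -lee_fin; apply: le_trans.
have [Mu Mu0 uM] := L1_Linfty_bounded (solution_class usol (ordS j)) ST.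
have mu_ s : 0 <= s <= S -> measurable_fun setT (u (ordS j) s).
  by move=> sS; have [] := in_L1_LinftyP ((solution_class usol (ordS j)).1 s (time_intervalP ST sS)).
have cu s e : 0 <= s <= S -> 0 < e -> \forall s' \near s, 0 <= s' <= S ->
    {ae mu, forall x, `|u (ordS j) s x - u (ordS j) s' x| <= e}.
  exact: (L1_Linfty_continuous (solution_class usol (ordS j)) ST).
have bphi := bounded_phi hpsi r psiM.
have [Phi iPhi PhiB] := isint_phi_le hpsi psiM r0.
set B := M ^+ 2 * (2 * r) ^+ n in Ua PhiB *.
have B0 : 0 <= B by rewrite mulr_ge0 ?sqr_ge0// exprn_ge0// mulr_ge0// ltW.
have k0 : 0 <= kappa := expR_ge0 _.
apply: (duhamel_pairing_ge (p1 j) Mu0 mu_ uM cu bphi t0t tS).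
  by rewrite mulr_ge0// mulr_ge0// powR_ge0.
move=> s ts; have /andP[t0s st] := ts.
have sS : 0 <= s <= S by rewrite (le_trans t00 t0s) (le_trans (ltW st)).
have ts0 : 0 < t - s by rewrite subr_gt0.
have tsS : 0 < t - s <= S by rewrite ts0 lerBlDr (le_trans tS)// lerDl; case/andP: sS.
have bs := bounded_source (p1 j) Mu0 mu_ sS.
have bc := bounded_clip Mu0 mu_ sS.
rewrite (heat_semigroup_adjoint ts0 bs bphi).
have H := isint_bounded_ge0_mul bc iPhi.1.
have cE : B * a <= \int[mu]_x (clip (u (ordS j)) Mu s x * phi psi r x).
  apply: (le_trans (Ua s ts)).
  have [hi hU] := isint_moment (ordS j) sS.
  have [ci cU] := H.
  rewrite -lee_fin -hU -cU.
  apply: (@le_trans _ _ (\int[mu]_x `|(phi psi r x * u (ordS j) s x)%:E|)%E).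
    apply: (le_integral measurableT hi (integrable_abse hi)) => x _ /=.
    by rewrite lee_fin ler_norm.
  rewrite le_eqVlt; apply/orP; left; apply/eqP; apply: ae_eq_integral => //.
  - exact: measurable_int (integrable_abse hi).
  - exact: measurable_int ci.
  - apply: filterS (clip_ae uM sS) => x xE _ /=.
    by rewrite xE normrM (ger0_norm (sqr_ge0 _)) mulrC.
have J := jensen_powR (p1 j) bc a0 (fun x => sqr_ge0 (psi (r^-1 *: x))) iPhi.1 _ cE.
have {}J : B * a `^ p j <= \int[mu]_x (source (u (ordS j)) (p j) Mu s x * phi psi r x).
  by apply: J; rewrite (isint_Rintegral iPhi).
have [si sI] := isintZ kappa (isint_bounded_ge0_mul bs iPhi.1).
apply: (@le_trans _ _ (kappa * \int[mu]_x (source (u (ordS j)) (p j) Mu s x * phi psi r x))%:E).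
  by rewrite lee_fin ler_wpM2l.
rewrite -sI; have [ms sM] := bs.
have s0 x : 0 <= source (u (ordS j)) (p j) Mu s x by case/andP: (sM x).
apply: ge0_le_integral => //.
- by move=> x _; rewrite lee_fin mulr_ge0// mulr_ge0// sqr_ge0.
- exact: measurable_int si.
- apply/measurable_EFinP; apply: measurable_funM => //.
  exact: (measurable_heat_semigroup ts0 bphi).
- by move=> x _; rewrite lee_fin mulrCA ler_wpM2l// heat_phi_kappa.
Qed.

End moments.

(** * Doubling along the cycle of components *)

(** With [e = rho^m]: adding one more waiting time to the partial sum
[c theta q (1 - rho^m) / (1 - rho)] of their geometric series. *)
Lemma geometric_time_step (R : fieldType) (c theta q rho e : R) : 1 - rho != 0 ->
  c * theta / (1 - rho) * q * (1 - e) + c * (theta * (e * q)) =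
  c * theta / (1 - rho) * q * (1 - rho * e).
Proof. by move=> h; field. Qed.

Lemma powR_expr (R : realType) (x y : R) m : 0 <= x -> (x ^+ m) `^ y = (x `^ y) ^+ m.
Proof.
move=> x0; rewrite -[x ^+ m]powR_mulrn// -[RHS]powR_mulrn; last exact: powR_ge0.
by rewrite -!powRrM mulrC.
Qed.

Section doubling.
Variables (R : realType) (k : nat) (p : 'I_k.+1 -> R).
Hypotheses (p1 : forall j, 1 <= p j) (p_gt1 : exists j, 1 < p j).
Implicit Types (j : 'I_k.+1) (a t tau : R).

(** The exponent to which the bound is raised after [m] components, starting
from [j]. *)
Definition chain_power m j : R := \prod_(i < m) p (iter i (@ordS k.+1) j).

(** The exponent collected by the waiting time after [m] components. *)
Definition chain_time m j : R := \sum_(h < m) chain_power h j.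

Lemma chain_powerS m j : chain_power m.+1 j = p j * chain_power m (ordS j).
Proof.
rewrite /chain_power big_ord_recl; congr (_ * _).
by apply: eq_bigr => i _; rewrite /= -iterS iterSr.
Qed.

Lemma chain_timeS m j : chain_time m.+1 j = 1 + p j * chain_time m (ordS j).
Proof.
rewrite /chain_time big_ord_recl /chain_power big_ord0; congr (_ + _).
rewrite mulr_sumr; apply: eq_bigr => h _; exact: chain_powerS.
Qed.

Lemma chain_time_ge0 m j : 0 <= chain_time m j.
Proof.
rewrite sumr_ge0// => h _; rewrite prodr_ge0// => i _.
exact: le_trans ler01 (p1 _).
Qed.

Lemma val_iter_ordS m j : (iter m (@ordS k.+1) j : nat) = ((j + m) %% k.+1)%N.
Proof.
elim: m => [|m ih]; first by rewrite addn0 modn_small.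
by rewrite iterS /= ih -addn1 modnDml addn1 addnS.
Qed.

Lemma iter_ordS_period j : iter k.+1 (@ordS k.+1) j = j.
Proof. by apply: val_inj; rewrite [LHS](val_iter_ordS k.+1 j) modnDr modn_small. Qed.

Lemma chain_power_period j : chain_power k.+1 j = \prod_i p i.
Proof.
rewrite /chain_power [RHS](reindex_inj (h := fun i : 'I_k.+1 => iter i (@ordS k.+1) j))//.
move=> i1 i2 /(congr1 (@nat_of_ord k.+1)); rewrite (val_iter_ordS i1 j) (val_iter_ordS i2 j) => /eqP.
by rewrite eqn_modDl !modn_small// => /eqP /val_inj.
Qed.

Lemma alphaE j : alpha p j = chain_time k.+1 j / (chain_power k.+1 j - 1).
Proof.
rewrite chain_power_period /alpha; congr (_ / _).
rewrite /chain_time big_ord_recl addrC; congr (_ + _).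
by rewrite /chain_power big_ord0.
Qed.

Lemma chain_power_gt1 j : 1 < chain_power k.+1 j.
Proof.
rewrite chain_power_period; have [j1 pj1] := p_gt1.
rewrite (bigD1 j1)//= (lt_le_trans pj1)// ler_peMr//.
  exact: le_trans ler01 (p1 j1).
by elim/big_ind: _ => // x y x1 y1; rewrite mulr_ege1.
Qed.

Variables (X : 'I_k.+1 -> R -> R) (kappa S : R).
Hypothesis kappa0 : 0 < kappa.
Hypothesis X_source : forall j t0 t a, 0 <= t0 <= t -> t <= S -> 0 <= a ->
  (forall s, t0 <= s < t -> a <= X (ordS j) s) -> (t - t0) * (kappa * a `^ p j) <= X j t.

(** Iterates [X_source] over [m] successive components, waiting [tau] before
each use so that the elapsed time factor is at least [tau]. The bound starts at
the last component of the chain and ends at [j]. *)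
Lemma chain_step m j tau t0 a : 0 < tau -> 0 <= t0 -> 0 < a ->
  (forall t, t0 <= t <= S -> a <= X (iter m (@ordS k.+1) j) t) ->
  forall t, t0 + m%:R * tau <= t <= S ->
    (kappa * tau) `^ chain_time m j * a `^ chain_power m j <= X j t.
Proof.
move=> tau0 t00 a0; have kt0 : 0 < kappa * tau by rewrite mulr_gt0.
elim: m j => [|m ih] j Xa t.
  rewrite mul0r addr0 /chain_time /chain_power !big_ord0 powRr0 mul1r powRr1 ?(ltW a0)//.
  exact: Xa.
move=> /andP[tm tS].
have {}ih := ih (ordS j); rewrite -iterSr in ih.
pose b := (kappa * tau) `^ chain_time m (ordS j) * a `^ chain_power m (ordS j).
have b0 : 0 <= b by rewrite mulr_ge0 ?powR_ge0.
pose t1 := t0 + m%:R * tau.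
have t10 : 0 <= t1 by rewrite addr_ge0// mulr_ge0// ltW.
have t1t : t1 + tau <= t.
  by move: tm; rewrite /t1 -addrA -natr1 mulrDl mul1r.
have h : (t - t1) * (kappa * b `^ p j) <= X j t.
  apply: X_source => //; first by rewrite t10/= (le_trans _ t1t)// lerDl ltW.
  move=> s /andP[s1 s2]; apply: ih; first exact: Xa.
  by rewrite s1 (le_trans (ltW s2)).
apply: le_trans h; rewrite chain_timeS chain_powerS.
have -> : (kappa * tau) `^ (1 + p j * chain_time m (ordS j)) * a `^ (p j * chain_power m (ordS j)) =
    tau * (kappa * b `^ p j).
  rewrite powRD ?(gt_eqF kt0) ?implybT// powRr1 ?(ltW kt0)//.
  rewrite /b [b `^ p j]powRM ?powR_ge0// -!powRrM ![_ * p j]mulrC.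
  by ring.
rewrite ler_wpM2r ?mulr_ge0 ?powR_ge0 ?(ltW kappa0)//.
by rewrite lerBrDl.
Qed.

(** [k.+1] waiting times of length [theta a^{- 1 / alpha}], with
[theta = 2^{1 / s} / kappa], double the bound [a]; doubling [a] shrinks the
waiting time by [2^{- 1 / alpha}], and the geometric series is summed. *)
Definition doubling_const j : R :=
  k.+1%:R * (2 `^ (chain_time k.+1 j)^-1 / kappa) / (1 - 2 `^ (- (alpha p j)^-1)).

Lemma chain_time_gt0 m j : 0 < chain_time m.+1 j.
Proof.
rewrite chain_timeS (lt_le_trans ltr01)// lerDl mulr_ge0 ?chain_time_ge0//.
exact: le_trans ler01 (p1 j).
Qed.

Lemma alpha_gt0 j : 0 < alpha p j.
Proof. by rewrite alphaE divr_gt0 ?chain_time_gt0// subr_gt0 chain_power_gt1. Qed.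

Lemma half_power_lt1 j : 2 `^ (- (alpha p j)^-1) < 1 :> R.
Proof.
have a0 : 0 < (alpha p j)^-1 by rewrite invr_gt0 alpha_gt0.
rewrite powRN invf_lt1 ?powR_gt0//.
have := gt0_ltr_powR a0 (x := 1) (y := 2); rewrite !nnegrE powR1; apply => //.
by rewrite ltr1n.
Qed.

Lemma doubling_const_gt0 j : 0 < doubling_const j.
Proof.
by rewrite divr_gt0 ?subr_gt0 ?half_power_lt1// mulr_gt0// divr_gt0 ?powR_gt0.
Qed.

(** With this [tau], [(kappa tau)^s = 2 a^{- s / alpha} = 2 a^{1 - P}], because
[alpha = s / (P - 1)]. *)
Lemma chain_doubling j tau t0 a : 0 < a -> 0 <= t0 ->
  tau = 2 `^ (chain_time k.+1 j)^-1 / kappa * a `^ (- (alpha p j)^-1) ->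
  (forall t, t0 <= t <= S -> a <= X j t) ->
  forall t, t0 + k.+1%:R * tau <= t <= S -> 2 * a <= X j t.
Proof.
move=> a0 t00 tauE Xa t tt.
have tau0 : 0 < tau by rewrite tauE mulr_gt0 ?powR_gt0// divr_gt0 ?powR_gt0.
have := @chain_step k.+1 j tau t0 a tau0 t00 a0; rewrite iter_ordS_period => /(_ Xa t tt).
apply: le_trans; rewrite le_eqVlt; apply/orP; left; apply/eqP.
have s0 := chain_time_gt0 k j; have P1 := chain_power_gt1 j.
have -> : kappa * tau = 2 `^ (chain_time k.+1 j)^-1 * a `^ (- (alpha p j)^-1).
  by rewrite tauE mulrA; congr (_ * _); rewrite mulrC divfK ?gt_eqF.
rewrite powRM ?powR_ge0// -!powRrM mulVf ?gt_eqF// powRr1// -mulrA; congr (_ * _).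
rewrite -powRD ?(gt_eqF a0) ?implybT// alphaE invf_div mulNr divfK ?gt_eqF//.
by rewrite opprB subrK powRr1// ltW.
Qed.

(** Otherwise [X_j(S)] would be at least [2^m a] for every [m]. *)
Lemma blowup_time_lt j a : 0 < a -> (forall t, 0 <= t <= S -> a <= X j t) ->
  S < doubling_const j * a `^ (- (alpha p j)^-1).
Proof.
move=> a0 Xa; rewrite ltNge; apply/negP => DS.
set rho : R := 2 `^ (- (alpha p j)^-1).
have rho1 : rho < 1 := half_power_lt1 j.
have rho0 : 0 < rho by rewrite powR_gt0.
have D0 := doubling_const_gt0 j.
pose A := doubling_const j * a `^ (- (alpha p j)^-1).
have A0 : 0 < A by rewrite mulr_gt0 ?powR_gt0.
have step m t : A * (1 - rho ^+ m) <= t <= S -> 2 ^+ m * a <= X j t.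
  elim: m t => [|m ih] t; first by rewrite expr0 subrr mulr0 mul1r; exact: Xa.
  move=> tt; rewrite exprS -mulrA.
  have am0 : 0 < 2 ^+ m * a by rewrite mulr_gt0// exprn_gt0.
  have rm1 : rho ^+ m <= 1 by rewrite exprn_ile1// ltW.
  apply: (chain_doubling am0 _ erefl ih); first by rewrite mulr_ge0 ?(ltW A0)// subr_ge0.
  have powE : (2 ^+ m * a) `^ (- (alpha p j)^-1) = rho ^+ m * a `^ (- (alpha p j)^-1).
    rewrite powRM ?exprn_ge0 ?(ltW a0)//; congr (_ * _).
    by apply: powR_expr; exact: ler0n.
  rewrite powE.
  have -> : A * (1 - rho ^+ m) + k.+1%:R * (2 `^ (chain_time k.+1 j)^-1 / kappa *
      (rho ^+ m * a `^ (- (alpha p j)^-1))) = A * (1 - rho ^+ m.+1).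
    by rewrite exprS; apply: geometric_time_step; rewrite gt_eqF// subr_gt0.
  exact: tt.
have [N NX] : exists N : nat, X j S / a < N%:R.
  by exists (Num.truncn (Num.max (X j S / a) 0)).+1;
   rewrite (le_lt_trans _ (truncnS_gt _))// le_max lexx.
have := step N S; rewrite lexx andbT => /(_ _)/wrap[].
  by rewrite (le_trans _ DS)// ler_piMr ?(ltW A0)// lerBlDr lerDl exprn_ge0// ltW.
apply/negP; rewrite -ltNge -ltr_pdivrMr// (lt_le_trans NX)//.
by rewrite -natrX ler_nat ltnW// ltn_expl.
Qed.

End doubling.

(** * Choice of the radius *)

Section scale_balance.
Variables (R : realType) (n : nat) (psi V : 'rV[R]_n -> R) (M : R).
Hypotheses (psiM : forall x, 0 <= psi x <= M) (cpsi : continuous psi).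
Hypothesis psi0 : 0 < psi 0.
Local Notation mu := (lebesgue_rV R n).
Hypotheses (V_ge0 : forall x, 0 <= V x) (iV : mu.-integrable setT (EFin \o V)).
Hypothesis V_gt0 : 0 < \int[mu]_x V x.
Implicit Types (x : 'rV[R]_n) (r y c : R).

Let mass r := \int[mu]_x (V x * phi psi r x).

Let bphi r : bounded_ge0 (M ^+ 2) (phi psi r) := bounded_scaled_sqr psiM cpsi r^-1.

Let isint_mass r : isint mu (fun x => V x * phi psi r x) (mass r).
Proof.
have := isint_bounded_ge0_mul (bphi r) iV.
rewrite /mass (_ : \int[mu]_x (V x * phi psi r x) = \int[mu]_x (phi psi r x * V x)).
  by apply: isint_ext => x; rewrite mulrC.
by apply: eq_Rintegral => x _; rewrite mulrC.
Qed.

Let mass_le r : mass r <= M ^+ 2 * \int[mu]_x V x.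
Proof.
apply: isint_le (isint_mass r) (isintZ (M ^+ 2) (isint_integrable iV)) _ => x.
by rewrite mulrC ler_wpM2r//; case/andP: ((bphi r).2 x).
Qed.

Let isint_bound : isint mu (fun x => M ^+ 2 * V x) (M ^+ 2 * \int[mu]_x V x).
Proof. exact: isintZ (isint_integrable iV). Qed.

Let term_le r x : `|V x * phi psi r x| <= M ^+ 2 * V x.
Proof.
have /andP[p0 pM] := (bphi r).2 x.
by rewrite (ger0_norm (mulr_ge0 (V_ge0 x) p0)) mulrC ler_wpM2r.
Qed.

(** Used both for the continuity of the mass in the radius and for its limit at
large radius. *)
Lemma cvg_scaled_sqr (T : Type) (F : set_system T) {FF : Filter F} (g : T -> R) (l : R) x :
  g t @[t --> F] --> l -> psi (g t *: x) ^+ 2 @[t --> F] --> psi (l *: x) ^+ 2.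
Proof.
move=> gl.
have h : psi (g t *: x) @[t --> F] --> psi (l *: x).
  apply: (@cvg_comp _ _ _ (fun t => g t *: x) psi); last exact: cpsi.
  apply: (@cvg_comp _ _ _ g (fun a => a *: x) _ _ _ gl).
  exact: scalel_continuous.
by rewrite !expr2; under eq_cvg do rewrite expr2; exact: cvgM.
Qed.

(** The radius is written [expR y] so that the parameter ranges over the whole
line. *)
Let continuous_mass : continuous (fun y => mass (expR y)).
Proof.
move=> y.
have H := @continuity_under_integral R _ _ mu (fun y x => V x * phi psi (expR y) x) setT
  measurableT (y - 1) (y + 1) (fun z _ => (isint_mass (expR z)).1) _ _ isint_bound.1.
apply: H; last by rewrite inE/= in_itv/= ltrDl ltr01 ltrBlDr ltrDl ltr01.
  apply: aeW => x _ z _.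
  rewrite (_ : (fun z => _) = (fun z => V x * psi (expR (- z) *: x) ^+ 2)); last first.
    by apply/funext => w; rewrite /phi expRN.
  rewrite /continuous_at.
  apply: cvgMr; apply: cvg_scaled_sqr; apply: (@cvg_comp _ _ _ -%R expR).
    exact: opp_continuous.
  exact: continuous_expR.
by move=> z _; apply: aeW => x _; exact: term_le.
Qed.

(** By dominated convergence the mass tends to [psi(0)^2] times the integral of
[V] as the radius goes to infinity. *)
Let mass_large : \forall N \near \oo,
  psi 0 ^+ 2 * \int[mu]_x V x / 2 <= mass (expR N%:R).
Proof.
have L0 : 0 < psi 0 ^+ 2 * \int[mu]_x V x by rewrite mulr_gt0// exprn_gt0.
set L := psi 0 ^+ 2 * _ in L0 *.
have cvgL : mass (expR N%:R) @[N --> \oo] --> L.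
  have [iL EL] := isintZ (psi 0 ^+ 2) (isint_integrable iV).
  have := @dominated_cvg _ _ _ mu setT measurableT
    (fun N x => (V x * phi psi (expR N%:R) x)%:E) (fun x => (psi 0 ^+ 2 * V x)%:E)
    (fun x => (M ^+ 2 * V x)%:E) _ _ _ isint_bound.1 _.
  rewrite EL => /(_ _ _ _ _)/wrap[].
  - by move=> N; have [hi _] := isint_mass (expR N%:R); exact: measurable_int hi.
  - move=> x _; apply: cvg_EFin; first exact: nearW.
    rewrite mulrC; apply: cvgMr; rewrite -(scale0r x).
    rewrite (_ : (fun N => _) = (fun N : nat => psi (expR (- N%:R) *: x) ^+ 2)); last first.
      by apply/funext => N; rewrite /phi expRN.
    apply: (@cvg_scaled_sqr nat _ _ (fun N => expR (- N%:R)) 0).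
    exact: (cvg_comp _ _ cvgr_idn (@cvgr_expR R)).
  - by move=> x _.
  - by move=> N x _; rewrite lee_fin term_le.
  have -> : (fun N => (\int[mu]_x (V x * phi psi (expR N%:R) x)%:E)%E) = (fun N => (mass (expR N%:R))%:E).
    by apply/funext => N; have [_ ->] := isint_mass (expR N%:R).
  by move/fine_cvg.
have L2 : L / 2 < L by rewrite ltr_pdivrMr// ltr_pMr// ltr1n.
near=> N; apply: ltW; near: N; exact: cvgr_gt cvgL _ L2.
Unshelve. all: end_near. Qed.

(** Intermediate value theorem: the mass is bounded by [M^2] times the integral
of [V], so the product is small for small radii, and it is large for large
radii by [mass_large]. *)
Lemma scale_balance c K : 0 < c -> 0 < K ->
  exists2 r, 0 < r & r `^ c * \int[mu]_x (V x * phi psi r x) = K.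
Proof.
move=> c0 K0.
pose f y := expR (c * y) * mass (expR y).
suff [y fy] : exists y, f y = K.
  exists (expR y); first exact: expR_gt0.
  by rewrite -fy /f mulrC [c * y]mulrC expRM mulrC.
have cf : continuous f.
  move=> y; apply: cvgM; last exact: continuous_mass.
  apply: (@cvg_comp _ _ _ (fun z => c * z) expR); last exact: continuous_expR.
  exact: mulrl_continuous.
pose A := M ^+ 2 * \int[mu]_x V x + 1.
have A0 : 0 < A by rewrite ltr_wpDl// mulr_ge0 ?sqr_ge0 ?(ltW V_gt0).
have L0 : 0 < psi 0 ^+ 2 * \int[mu]_x V x / 2 by rewrite divr_gt0// mulr_gt0// exprn_gt0.
set L := _ / 2 in L0.
pose y1 := ln (K / A) / c.
have fy1 : f y1 <= K.
  rewrite /f /y1 mulrC mulrCA mulfV ?gt_eqF// mulr1 lnK ?posrE ?divr_gt0//.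
  rewrite -[leRHS](divfK (lt0r_neq0 A0)) mulrC ler_wpM2l ?divr_ge0 ?(ltW K0) ?(ltW A0)//.
  by rewrite (le_trans (mass_le _))// lerDl.
have [N [yN aN mN]] : exists N : nat,
    [/\ y1 <= N%:R, ln (K / L) / c <= N%:R & L <= mass (expR N%:R)].
  near \oo => N; exists N; split; near: N; [exact: nbhs_infty_ger..|exact: mass_large].
have fN : K <= f N%:R.
  have KL : 0 < K / L by exact: divr_gt0.
  rewrite -[leLHS](divfK (lt0r_neq0 L0)); apply: ler_pM mN; [exact: ltW..|].
  by rewrite -[leLHS]lnK ?posrE// ler_expR -ler_pdivrMl// mulrC.
clearbody f y1; have [|y _ fy] := @IVT _ f y1 N%:R K yN (continuous_subspaceT cf).
  by rewrite ge_min fy1/= le_max fN orbT.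
by exists y.
Unshelve. all: end_near. Qed.

End scale_balance.

(** * Upper bound on the lifespan *)

(** Turns the threshold on the moment [m] into one on the normalized initial
value [kappa m / B], where [B = b w]. *)
Lemma rescaled_threshold (R : realFieldType) (d b kappa q w m : R) :
  0 < kappa -> 0 < b -> 0 < q -> 0 < w ->
  d * b / kappa <= q / w * m -> d / q <= kappa * m / (b * w).
Proof.
move=> k0 b0 q0 w0; rewrite !ler_pdivrMr// => h.
rewrite mulrAC ler_pdivlMr ?mulr_gt0//.
have := ler_wpM2r (ltW w0) h; congr (_ <= _); first by ring.
by field; rewrite gt_eqF.
Qed.

Lemma powR_div (R : realType) (x y a : R) : 0 <= x -> 0 <= y ->
  (x / y) `^ a = x `^ a / y `^ a.
Proof.
move=> x0 y0; rewrite powRM ?invr_ge0//; congr (_ * _).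
by rewrite -(powR_inv1 y0) powRAC powR_inv1 ?powR_ge0.
Qed.

Lemma powR_scaling (R : realType) (r a : R) n : 0 < r ->
  r `^ (2 * (a - n%:R / 2)) = (r ^+ 2) `^ a / r ^+ n.
Proof.
move=> r0; rewrite (_ : 2 * _ = 2 * a - n%:R); last by field.
rewrite powRB ?(gt_eqF r0) ?implybT// powR_mulrn ?(ltW r0)//.
by rewrite powRrM -(powR_mulrn 2 (ltW r0)).
Qed.

Section blowup.
Variables (R : realType) (n k : nat) (lambda : R) (psi : 'rV[R]_n -> R).
Hypotheses (lambda0 : 0 < lambda) (hpsi : is_ball_eigenfunction lambda psi).
Variables (p : 'I_k.+1 -> R) (u0 : 'I_k.+1 -> 'rV[R]_n -> R).
Variable u : 'I_k.+1 -> R -> 'rV[R]_n -> R.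
Hypotheses (p1 : forall j, 1 <= p j) (p_gt1 : exists j, 1 < p j).
Hypothesis u0C : forall j, in_L1_Linfty (u0 j).
Hypothesis u0_ge0 : forall j, {ae lebesgue_rV R n, forall x, 0 <= u0 j x}.
Variables (T : \bar R) (M : R).
Hypotheses (M0 : 0 < M) (psiM : forall x, 0 <= psi x <= M).
Hypothesis usol : is_solution p u0 T u.

(** [D^alpha B_1 / kappa], where [D a^{- 1 / alpha}] is the blow-up time of the
doubling argument and [B_1] bounds the integral of [phi_1]. *)
Definition critical_moment j : R :=
  doubling_const p (expR (- lambda)) j `^ alpha p j * (M ^+ 2 * 2 ^+ n) / expR (- lambda).

Lemma critical_moment_gt0 j : 0 < critical_moment j.
Proof.
rewrite divr_gt0 ?expR_gt0// mulr_gt0 ?powR_gt0 ?doubling_const_gt0 ?expR_gt0//.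
by rewrite mulr_gt0// exprn_gt0.
Qed.

(** If the solution lived beyond [r^2], the moments divided by [B] would satisfy
the hypotheses of the doubling argument up to time [r^2] with initial bound
[kappa U_j(0) / B], whose blow-up time is at most [r^2]. *)
Lemma time_le_of_moment j r : 0 < r ->
  critical_moment j <= r `^ (2 * (alpha p j - n%:R / 2)) * moment psi u j r 0 ->
  (T <= (r ^+ 2)%:E)%E.
Proof.
move=> r0 crit; rewrite leNgt; apply/negP => rT.
set kappa := expR (- lambda).
have kappa0 : 0 < kappa := expR_gt0 _.
have S0 : 0 < r ^+ 2 by rewrite exprn_gt0.
pose B := M ^+ 2 * (2 * r) ^+ n.
have B0 : 0 < B by rewrite mulr_gt0// ?exprn_gt0// mulr_gt0.
pose X i t := moment psi u i r t / B.
have X_source i t0 t a : 0 <= t0 <= t -> t <= r ^+ 2 -> 0 <= a ->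
    (forall s, t0 <= s < t -> a <= X (ordS i) s) -> (t - t0) * (kappa * a `^ p i) <= X i t.
  move=> t0t tr a0 Xa; rewrite ler_pdivlMr//.
  have := moment_ge_source lambda0 hpsi p1 u0C u0_ge0 S0 rT r0 (lexx _) usol psiM t0t tr a0 _ (j := i).
  rewrite -/B -/kappa => h; rewrite (le_trans _ (h _))//.
    by rewrite -mulrA -(mulrA kappa) (mulrC _ B).
  by move=> s /Xa; rewrite ler_pdivlMr// mulrC.
pose a := kappa * moment psi u j r 0 / B.
set D := doubling_const p kappa j in crit.
have D0 : 0 < D by exact: doubling_const_gt0.
have al0 : 0 < alpha p j by exact: alpha_gt0.
have Da : (D / r ^+ 2) `^ alpha p j <= a.
  have -> : (D / r ^+ 2) `^ alpha p j = D `^ alpha p j / (r ^+ 2) `^ alpha p j.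
    by apply: powR_div; exact: ltW.
  have -> : a = kappa * moment psi u j r 0 / (M ^+ 2 * 2 ^+ n * r ^+ n).
    by rewrite /a /B exprMn mulrA.
  apply: rescaled_threshold; rewrite ?powR_gt0 ?exprn_gt0 ?mulr_gt0//.
  by rewrite -(powR_scaling _ _ r0).
have a0 : 0 < a by rewrite (lt_le_trans _ Da)// powR_gt0// divr_gt0.
have Xa t : 0 <= t <= r ^+ 2 -> a <= X j t.
  move=> tS; rewrite ler_wpM2r ?invr_ge0 ?(ltW B0)//.
  exact: (moment_ge_initial lambda0 hpsi p1 u0C u0_ge0 S0 rT r0 (lexx _) usol).
have := blowup_time_lt p1 p_gt1 kappa0 X_source a0 Xa; rewrite -/D; apply/negP; rewrite -leNgt.
have D1 : 0 <= D / r ^+ 2 := ltW (divr_gt0 D0 S0).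
have : D / r ^+ 2 <= a `^ (alpha p j)^-1.
  rewrite -(powRr1 D1) -(mulfV (lt0r_neq0 al0)) powRrM; apply: ge0_ler_powR Da.
  - by rewrite invr_ge0 ltW.
  - by rewrite nnegrE powR_ge0.
  - by rewrite nnegrE ltW.
by rewrite (ler_pdivrMr _ _ S0) powRN (ler_pdivrMr _ _ (powR_gt0 _ a0)) mulrC.
Qed.

End blowup.

Lemma Rintegral_norm_gt0 (R : realType) n (f : 'rV[R]_n -> R) :
  (lebesgue_rV R n).-integrable setT (EFin \o f) ->
  ~ {ae lebesgue_rV R n, forall x, f x = 0} -> 0 < \int[lebesgue_rV R n]_x `|f x|.
Proof.
move=> fi fn0; rewrite lt_def Rintegral_ge0 ?andbT//; apply/negP => /eqP f0.
apply: fn0; have [ni nE] := isint_integrable (integrable_norm fi).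
move: nE; rewrite f0 => /(ae_eq_integral_abs _ measurableT (measurable_int _ fi)).
by apply: filterS => x /(_ I) [].
Qed.

(** At time [0] the moment only depends on the class of the datum, whose norm
is a representative that is nonnegative everywhere. *)
Lemma moment_initialE (R : realType) n k (p : 'I_k -> R) (psi : 'rV[R]_n -> R) M u0 T u j r :
  bounded_ge0 M (phi psi r) -> in_L1_Linfty (u0 j) ->
  {ae lebesgue_rV R n, forall x, 0 <= u0 j x} -> (0 < T)%E -> is_solution p u0 T u ->
  moment psi u j r 0 = \int[lebesgue_rV R n]_x (`|u0 j x| * phi psi r x).
Proof.
move=> [mphi _] u0C u0_ge0 T0 usol.
have [mu0 _ _] := in_L1_LinftyP u0C.
have [mut _ _] : [/\ measurable_fun setT (u j 0), _ & _] :=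
  in_L1_LinftyP ((solution_class usol j).1 0 (conj (lexx 0) T0)).
rewrite /moment /Rintegral; congr fine; apply: ae_eq_integral => //.
- by apply/measurable_EFinP; exact: measurable_funM.
- by apply/measurable_EFinP; apply: measurable_funM => //; exact: measurableT_comp.
- apply: filterS2 u0_ge0 (solution_init usol j T0) => x u0x -> _ /=.
  by rewrite ger0_norm.
Qed.

Theorem theorem1p4 (R : realType) (n k : nat) (hn : (1 <= n)%N) (hk : (1 <= k)%N)
    (lambda : R) (hlambda : 0 < lambda)
    (psi : 'rV[R]_n -> R) (hpsi : is_ball_eigenfunction lambda psi)
    (p : 'I_k -> R) (hp : forall j, 1 <= p j) (hp1 : exists j, 1 < p j)
    (j0 : 'I_k) (halpha : n%:R / 2 < alpha p j0) :
  exists C0 : R, 0 < C0 /\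
    forall (u0 : 'I_k -> 'rV[R]_n -> R) (u : 'I_k -> R -> 'rV[R]_n -> R),
      (forall j, in_L1_Linfty (u0 j)) ->
      (forall j, {ae lebesgue_rV R n, forall x, 0 <= u0 j x}) ->
      is_solution p u0 (lifespan p u0) u ->
      ~ {ae lebesgue_rV R n, forall x, u0 j0 x = 0} ->
      (lifespan p u0 < +oo)%E /\
      exists R0 : R, 0 < R0 /\
        (lifespan p u0 <=
           (C0 * moment psi u j0 R0 0 `^ (- (1 / (alpha p j0 - n%:R / 2))))%:E)%E.
Proof.
case: k hk p hp hp1 j0 halpha => // k _ p hp hp1 j0 halpha.
have [M M0 psiM] := eigen_bounded hpsi.
set gamma := alpha p j0 - n%:R / 2.
have gamma0 : 0 < gamma by rewrite subr_gt0.
pose K := critical_moment n lambda p M j0.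
have K0 : 0 < K by exact: critical_moment_gt0.
exists (K `^ (1 / gamma)); split; first exact: powR_gt0.
move=> u0 u u0C u0_ge0 usol u0n0; set T := lifespan p u0 in usol *.
(* Without any solution on a positive time interval the lifespan is -oo. *)
have [T0|T0] := leP T 0%E.
  split; first by rewrite (le_lt_trans T0)// ltry.
  by exists 1; split => //; rewrite (le_trans T0)// lee_fin mulr_ge0// powR_ge0.
have [_ iu0 _] := in_L1_LinftyP (u0C j0).
have gamma20 : 0 < 2 * gamma by rewrite mulr_gt0.
have [r r0 rK] := scale_balance psiM (ball_eigen_continuous hpsi) (eigen_gt0 hlambda hpsi)
  (fun x => normr_ge0 (u0 j0 x)) (integrable_norm iu0) (Rintegral_norm_gt0 iu0 u0n0) gamma20 K0.
rewrite -(moment_initialE (bounded_phi hpsi r psiM) (u0C j0) (u0_ge0 j0) T0 usol) in rK.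
have Tr : (T <= (r ^+ 2)%:E)%E.
  by apply: (time_le_of_moment hlambda hpsi hp hp1 u0C u0_ge0 M0 psiM usol (j := j0) r0); rewrite rK.
split; first by rewrite (le_lt_trans Tr)// ltry.
exists r; split => //; apply: (le_trans Tr); rewrite lee_fin.
set U := moment psi u j0 r 0 in rK *.
have U0 : 0 < U by move: K0; rewrite -rK pmulr_rgt0// powR_gt0.
rewrite -rK powRM ?powR_ge0 ?(ltW U0)// -mulrA -powRD ?(gt_eqF U0) ?implybT//.
rewrite subrr powRr0 mulr1 -powRrM mulrA mulr1 mulfK ?gt_eqF//.
by rewrite powR_mulrn// ltW.
Qed.
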